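(* Let $k\ge 4$ and let $G$ be a $k$-connected graph with an odd number of vertices, at least $2k+3$ vertices, and a vertex cut $S$ of size $k$ such that $G-S$ has two components with at least $3$ vertices each. Then $G$ has independence number at most $2$ if and only if $G$ is equimatchable and factor-critical.
   Context: All graphs are finite, simple and undirected. A graph is equimatchable if every maximal matching is a maximum matching. A graph is factor-critical if $G-v$ has a perfect matching for every vertex $v$. The independence number is the maximum size of an independent set of vertices. *)

(* Defs.v *)
From mathcomp Require Import all_boot.
Set Implicit Arguments. Unset Strict Implicit. Unset Printing Implicit Defensive.

Record sgraph := SGraph {
  vertex :> finType;
  adj : rel vertex;
  adj_sym : symmetric adj;
  adj_irrefl : irreflexive adj }.

(* A set A of vertices also stands for the subgraph G[A] that it induces:
   [set: G] is G itself, ~: S is G - S and [set~ v] is G - v. *)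
Section Graph.
Variable G : sgraph.
Implicit Types (A S : {set G}) (M : {set {set G}}).

(* An edge is the set of its two ends. *)
Definition edges A : {set {set G}} :=
  [set [set x; y] | x in A, y in A & adj x y].

Definition linked A : rel G := connect [rel x y in A | adj x y].

(* The empty graph counts as connected; this is harmless in k_connected, which
   never deletes all the vertices. *)
Definition connected A : Prop := {in A &, forall x y, linked A x y}.

Definition components A : {set {set G}} := equivalence_partition (linked A) A.

Definition k_connected (k : nat) : Prop :=
  k < #|G| /\ forall S, #|S| < k -> connected (~: S).

Definition vertex_cut S : Prop := ~ connected (~: S).

Definition matching A M : bool := (M \subset edges A) && trivIset M.

Definition maximal_matching A M : bool := maxset (matching A) M.

Definition maximum_matching A M : Prop :=
  matching A M /\ forall M', matching A M' -> #|M'| <= #|M|.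

Definition perfect_matching A M : bool := matching A M && (cover M == A).

Definition equimatchable : Prop :=
  forall M, maximal_matching [set: G] M -> maximum_matching [set: G] M.

Definition factor_critical : Prop :=
  forall v : G, exists M, perfect_matching [set~ v] M.

Definition independent A : bool := [forall x in A, forall y in A, ~~ adj x y].

Definition independence_number : nat := \max_(A : {set G} | independent A) #|A|.

End Graph.

Arguments k_connected : clear implicits.
Arguments equimatchable : clear implicits.
Arguments factor_critical : clear implicits.
Arguments independence_number : clear implicits.

(* Main.v *)
(** If the independence number is at most 2, the vertices missed by a maximal
    matching are independent, so parity leaves exactly one of them; and a Tutte
    barrier of G - v would have to be empty, against connectivity.

    Conversely, suppose that G is equimatchable and factor-critical and that T
    is an independent triple.  Since G - T has no perfect matching, it has a
    Tutte barrier X, and Y = X + T leaves |Y| - 1 odd blocks.  Any matching can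
    be completed so as to miss one vertex only, which bounds the number of
    vertices of Y that a matching can waste; connectivity provides wasteful
    matchings unless the blocks are nearly all trivial.  Hence G has a "tight"
    set Y: its complement Z is independent, |Y| = |Z| + 1, and G[Y] has no two
    disjoint edges.  Two tight sets nearly agree or are nearly complementary, so
    Y can be chosen with a vertex c such that each vertex of Y - c misses at
    most one vertex of Z.  Then Z has at most one vertex on each side of the cut
    S, and degrees smaller than k appear. *)

Require Import Defs.
From mathcomp Require Import all_boot zify.

Set Implicit Arguments.
Unset Strict Implicit.
Unset Printing Implicit Defensive.

(* The preprocessing of [lia] is very slow on hypotheses about memberships, and
   [lia] distinguishes convertible cardinals. *)
Ltac card_lia :=
  repeat match goal with
  | H : ?P |- _ =>
    lazymatch P with
    | is_true (leq _ _) => revert H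
    | is_true (odd _) => revert H
    | is_true (~~ odd _) => revert H
    | odd _ = _ => revert H
    | _ = _ :> nat => revert H
    | _ => clear H
    end
  end;
  repeat (let c := fresh "c" in move: #|_| => c); lia.

(** * König's theorem for bipartite graphs *)

Definition disjoint_pairs (I J : finType) (F : {set I * J}) : Prop :=
  {in F &, injective fst} /\ {in F &, injective snd}.

(** Distinct pairs of [F] need distinct cover elements, so the inequality already makes [F] a
    maximum matching and [(U, W)] a minimum cover. *)
Definition konig_duality (I J : finType) (E : {set I * J}) : Prop :=
  exists (F : {set I * J}) (U : {set I}) (W : {set J}),
    [/\ F \subset E, disjoint_pairs F,
        forall e, e \in E -> (e.1 \in U) || (e.2 \in W) & #|U| + #|W| <= #|F|].

Lemma konig_duality_swap (I J : finType) (E : {set I * J}) :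
  konig_duality [set (e.2, e.1) | e in E] -> konig_duality E.
Proof.
case=> F [U] [W] [sFE [inj1 inj2] cov leF].
have inj_swap (A B : Type) : injective (fun e : A * B => (e.2, e.1)).
  by case=> a b [c d] [-> ->].
exists [set (e.2, e.1) | e in F], W, U; split.
- apply/subsetP=> _ /imsetP[e eF ->].
  by have /imsetP[[a b] abE ->] := subsetP sFE _ eF.
- split=> _ _ /imsetP[[a b] aF ->] /imsetP[[c d] cF ->] /= eq_ac.
    by have [-> ->] := inj2 _ _ aF cF eq_ac.
  by have [-> ->] := inj1 _ _ aF cF eq_ac.
- by move=> e eE; rewrite orbC; apply: (cov (e.2, e.1)); apply: imset_f.
- by rewrite addnC card_imset //; apply: inj_swap.
Qed.

(* The two covers that minimum covers of E - (i,j) and E - (i,j') combine into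
   have total size at most one more than the sum of the sizes of these. *)
Lemma konig_duality_fork (I J : finType) (E : {set I * J}) i j j' :
    (i, j) \in E -> (i, j') \in E -> j != j' ->
    konig_duality (E :\ (i, j)) -> konig_duality (E :\ (i, j')) ->
  konig_duality E.
Proof.
move=> ijE ij'E neq_j [F1 [U1 [W1 [sF1 dF1 cov1 le1]]]].
case=> F2 [U2 [W2 [sF2 dF2 cov2 le2]]].
have sFE1 : F1 \subset E by apply: subset_trans sF1 (subsetDl _ _).
have sFE2 : F2 \subset E by apply: subset_trans sF2 (subsetDl _ _).
have full (F : {set I * J}) (U : {set I}) (W : {set J}) e :
    (forall e', e' \in E :\ e -> (e'.1 \in U) || (e'.2 \in W)) ->
    (e.1 \in U) || (e.2 \in W) ->
    forall e', e' \in E -> (e'.1 \in U) || (e'.2 \in W).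
  move=> cov eUW e' e'E; have [->//|ne] := eqVneq e' e.
  by apply: cov; rewrite !inE ne.
case e1 : ((i \in U1) || (j \in W1)).
  by exists F1, U1, W1; split=> //; apply: (full F1 _ _ (i, j)).
case e2 : ((i \in U2) || (j' \in W2)).
  by exists F2, U2, W2; split=> //; apply: (full F2 _ _ (i, j')).
have ij'1 : (i \in U1) || (j' \in W1).
  by apply: (cov1 (i, j')); rewrite !inE ij'E andbT xpair_eqE eqxx /= eq_sym.
have ij2 : (i \in U2) || (j \in W2).
  by apply: (cov2 (i, j)); rewrite !inE ijE andbT xpair_eqE eqxx.
have covI e : e \in E -> (e.1 \in U1 :&: U2) || (e.2 \in W1 :|: W2).
  move=> eE; rewrite !inE; have [->|ne] := eqVneq e (i, j) => /=.
    by move: e2 ij2; do !case: (_ \in _).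
  have [->|ne'] := eqVneq e (i, j') => /=.
    by move: e1 ij'1; do !case: (_ \in _).
  have := cov1 e; have := cov2 e; rewrite !inE ne ne' eE /=.
  by move=> /(_ isT) + /(_ isT); do !case: (_ \in _).
have covU e : e \in E -> (e.1 \in i |: (U1 :|: U2)) || (e.2 \in W1 :&: W2).
  move=> eE; rewrite !inE; have [->|ne] := eqVneq e (i, j) => /=.
    by rewrite eqxx.
  have [->|ne'] := eqVneq e (i, j') => /=; first by rewrite eqxx.
  have := cov1 e; have := cov2 e; rewrite !inE ne ne' eE /=.
  by move=> /(_ isT) + /(_ isT); do !case: (_ \in _); rewrite //= orbT.
have cU := cardsUI U1 U2; have cW := cardsUI W1 W2.
have cUi : #|i |: (U1 :|: U2)| <= #|U1 :|: U2|.+1 by rewrite cardsU1; card_lia.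
(* The two covers have total size at most [#|F1| + #|F2| + 1], so they cannot both exceed the larger
   of [#|F1|] and [#|F2|]. *)
have [le12|lt21] := leqP #|F1| #|F2|.
  have [leI|ltI] := leqP (#|U1 :&: U2| + #|W1 :|: W2|) #|F2|.
    by exists F2, (U1 :&: U2), (W1 :|: W2).
  exists F2, (i |: (U1 :|: U2)), (W1 :&: W2); split=> //; card_lia.
have [leI|ltI] := leqP (#|U1 :&: U2| + #|W1 :|: W2|) #|F1|.
  by exists F1, (U1 :&: U2), (W1 :|: W2).
by exists F1, (i |: (U1 :|: U2)), (W1 :&: W2); split=> //; card_lia.
Qed.

(** Induction on [#|E|]: two pairs with a common coordinate form a fork, after a swap if it is the
    second one; without such pairs [E] is itself a matching, covered by its first coordinates. *)
Lemma konig (I J : finType) (E : {set I * J}) : konig_duality E.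
Proof.
(* The index types are generalized too, because the swap exchanges them. *)
have [n] := ubnP #|E|; elim: n => // n IHn in I J E * => ltEn.
have cE (A B : finType) (H : {set A * B}) e : e \in H -> #|H| < n.+1 -> #|H :\ e| < n.
  by move=> eH; rewrite (cardsD1 e H) eH.
have fork (A B : finType) (H : {set A * B}) a b b' : #|H| < n.+1 ->
    (a, b) \in H -> (a, b') \in H -> b != b' -> konig_duality H.
  by move=> ltH abH ab'H ne; apply: (konig_duality_fork abH ab'H ne);
    apply/IHn/cE.
case: (boolP [exists e in E, exists e' in E, (e.1 == e'.1) && (e != e')]).
  move=> /exists_inP[[i j] ijE] /exists_inP[[i' j'] ij'E] /= /andP[/eqP eq_i].
  rewrite {}eq_i xpair_eqE eqxx /= in ijE * => ne.
  exact: fork ijE ij'E ne.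
move=> no1.
case: (boolP [exists e in E, exists e' in E, (e.2 == e'.2) && (e != e')]).
  move=> /exists_inP[[i j] ijE] /exists_inP[[i' j'] ij'E] /= /andP[/eqP eq_j].
  rewrite {}eq_j xpair_eqE eqxx andbT in ijE * => ne.
  apply: konig_duality_swap; apply: (@fork _ _ _ j' i i') => //.
  - by rewrite card_imset // => -[? ?] [? ?] [-> ->].
  - by apply/imsetP; exists (i, j').
  - by apply/imsetP; exists (i', j').
move=> no2.
have inj1 : {in E &, injective fst}.
  move=> e e' eE e'E eq_e; apply/eqP; apply: contraNT no1 => ne.
  by apply/exists_inP; exists e => //; apply/exists_inP; exists e';
    rewrite ?eq_e ?eqxx.
have inj2 : {in E &, injective snd}.
  move=> e e' eE e'E eq_e; apply/eqP; apply: contraNT no2 => ne.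
  by apply/exists_inP; exists e => //; apply/exists_inP; exists e';
    rewrite ?eq_e ?eqxx.
exists E, (fst @: E), set0; split=> //.
  by move=> e eE; rewrite imset_f.
by rewrite cards0 addn0 leq_imset_card.
Qed.

(** * Pairings, families of odd blocks, and Tutte's theorem *)

Section Matchable.
Variable G : sgraph.
Implicit Types (A B D K X Y : {set G}) (P Q : {set {set G}}) (f : G -> G).

(* f sends every vertex of A to its partner in a perfect matching of G[A]. *)
Definition pairing f A : Prop :=
  {in A, forall x, [/\ f x \in A, adj x (f x) & f (f x) = x]}.

Definition matchable A : Prop := exists f, pairing f A.

Lemma pairing_sub f A B :
  pairing f A -> B \subset A -> {in B, forall x, f x \in B} -> pairing f B.
Proof.
by move=> fA /subsetP sBA fB x xB; have [_ ? ?] := fA x (sBA x xB);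
  split=> //; apply: fB.
Qed.

Lemma pairing_diff f A B :
  pairing f A -> B \subset A -> {in B, forall x, f x \in B} ->
  pairing f (A :\: B).
Proof.
move=> fA sBA fB; apply: pairing_sub (fA) (subsetDl _ _) _ => x.
case/setDP=> xA xB; have [fxA _ ffx] := fA x xA.
by rewrite inE fxA andbT; apply: contra xB => /fB; rewrite ffx.
Qed.

Lemma matchable0 : matchable set0.
Proof. by exists id => x; rewrite inE. Qed.

Lemma matchable_pair x y : adj x y -> matchable [set x; y].
Proof.
move=> xy; exists (fun z => if z == x then y else x) => z.
rewrite !inE => /orP[]/eqP->; rewrite ?eqxx.
  by split; rewrite ?eqxx ?orbT //; case: eqP.
have /negPf-> : y != x by apply: contraTneq xy => ->; rewrite adj_irrefl.
by rewrite !eqxx; split; rewrite // adj_sym.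
Qed.

Lemma matchable_bigcup (I : finType) (F : {set I}) (B : I -> {set G}) :
  {in F &, forall i j, i != j -> [disjoint B i & B j]} ->
  {in F, forall i, matchable (B i)} -> matchable (\bigcup_(i in F) B i).
Proof.
move=> disB mB.
have /fin_all_exists[g gB] i : exists f, i \in F -> pairing f (B i).
  by case: (boolP (i \in F)) => [/mB[f]|_]; [exists f | exists id].
pose h x := if [pick i in F | x \in B i] is Some i then g i x else x.
have hE i x : i \in F -> x \in B i -> h x = g i x.
  move=> iF xi; rewrite /h; case: pickP => [j /andP[jF xj]|/(_ i)]; last first.
    by rewrite iF xi.
  have [-> //|/(disB _ _ jF iF)/disjoint_setI0 /setP/(_ x)] := eqVneq j i.
  by rewrite !inE xi xj.
exists h => x /bigcupP[i iF xi]; have [gx ax ggx] := gB i iF x xi.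
by rewrite (hE i) // (hE i) //; split=> //; apply/bigcupP; exists i.
Qed.

Lemma matchableU A B :
  [disjoint A & B] -> matchable A -> matchable B -> matchable (A :|: B).
Proof.
move=> disAB mA mB.
have -> : A :|: B = \bigcup_(b in [set: bool]) (if b then A else B).
  by apply/setP=> x; apply/setUP/bigcupP=> [[] ?|[[] _ ?]];
    [exists true | exists false | left | right].
apply: matchable_bigcup => [[] [] _ _|[] _] //= _.
by rewrite disjoint_sym.
Qed.

Lemma matchable_even A : matchable A -> ~~ odd #|A|.
Proof.
case=> f; have [n] := ubnP #|A|; elim: n => // n IHn in A * => ltAn fA.
have [->|[x xA]] := set_0Vmem A; first by rewrite cards0.
have [fxA axf ffx] := fA x xA.
have nefx : x != f x by apply: contraTneq axf => <-; rewrite adj_irrefl.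
have sxA : [set x; f x] \subset A by rewrite subUset !sub1set xA.
have cA : #|A :\: [set x; f x]| + 2 = #|A|.
  by rewrite -(cardsID [set x; f x] A) (setIidPr sxA) cards2 nefx addnC.
have := IHn (A :\: [set x; f x]); rewrite -cA oddD addbF; apply.
  by card_lia.
apply: pairing_diff => // y; rewrite !inE => /orP[]/eqP->.
  by rewrite eqxx orbT.
by rewrite ffx eqxx.
Qed.

(** A possibly empty union of components of [G[B]]. Not asking for connectedness lets blocks be
    merged and cut freely. *)
Definition isolated B K : bool :=
  (K \subset B) && [forall x in K, forall y in B, adj x y ==> (y \in K)].

Lemma isolatedP B K :
  reflect (K \subset B /\ forall x y, x \in K -> y \in B -> adj x y -> y \in K)
          (isolated B K).
Proof.
apply: (iffP andP) => [][sKB isoK]; split=> //.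
  move=> x y xK yB; apply: implyP.
  by have /forall_inP/(_ y yB) := forall_inP isoK x xK.
by apply/forall_inP=> x xK; apply/forall_inP=> y yB; apply/implyP; apply: isoK.
Qed.

Lemma isolatedD B K D : isolated B K -> isolated (B :\: D) (K :\: D).
Proof.
case/isolatedP=> sKB isoK; apply/isolatedP; split; first exact: setSD.
move=> x y /setDP[xK _] /setDP[yB yD] axy.
by rewrite inE yD (isoK x).
Qed.

Lemma isolated_trans B K D K' :
  isolated B K -> isolated (K :\: D) K' -> isolated (B :\: D) K'.
Proof.
case/isolatedP=> /subsetP sKB isoK /isolatedP[/subsetP sK' isoK'].
apply/isolatedP; split=> [|x y xK' /setDP[yB yD] axy].
  by apply/subsetP=> x /sK'; rewrite !inE => /andP[-> /sKB].
have /setDP[xK _] := sK' x xK'.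
by apply: (isoK' x) => //; rewrite inE yD (isoK x).
Qed.

(** Each block contains an odd component of [G[B]], so [#|P|] bounds the number of odd components
    from below; Tutte's condition is stated with such families. *)
Definition odd_family B P : bool :=
  [&& trivIset P, [forall K in P, odd #|K|] & [forall K in P, isolated B K]].

Lemma odd_familyP B P :
  reflect [/\ trivIset P, {in P, forall K, odd #|K|} &
              {in P, forall K, isolated B K}] (odd_family B P).
Proof.
by apply: (iffP and3P) => -[tP oP iP]; split=> //;
  try exact/forall_inP; move=> K; apply/forall_inP.
Qed.

Lemma odd_family_subset B P Q : Q \subset P -> odd_family B P -> odd_family B Q.
Proof.
move=> /subsetP sQP /odd_familyP[tP oP iP]; apply/odd_familyP.
split=> [|K /sQP/oP //|K /sQP/iP //].
by apply: trivIsetS tP; apply/subsetP.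
Qed.

Lemma cover_odd_family B P : odd_family B P -> cover P \subset B.
Proof.
by case/odd_familyP=> _ _ iP; apply/bigcupsP=> K /iP/isolatedP[].
Qed.

Lemma odd_block_neq0 K : odd #|K| -> exists x, x \in K.
Proof. by case: (set_0Vmem K) => [->|[x]]; [rewrite cards0 | exists x]. Qed.

Lemma odd_card_cover B P : odd_family B P -> odd #|cover P| = odd #|P|.
Proof.
case/odd_familyP=> tP oP _; have /eqP <- := tP.
rewrite -sum1_card !(big_morph odd oddD (erefl _)).
exact: eq_bigr.
Qed.

Lemma isolated_leftover B P : odd_family B P -> isolated B (B :\: cover P).
Proof.
move=> oddP; have /odd_familyP[_ _ iP] := oddP.
apply/isolatedP; split=> [|x y /setDP[xB xP] yB axy]; first exact: subsetDl.
rewrite inE yB andbT; apply: contra xP => /bigcupP[K KP yK].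
apply/bigcupP; exists K => //; have /isolatedP[_ isoK] := iP K KP.
by apply: (isoK y); rewrite // adj_sym.
Qed.

Lemma odd_family_add B P K :
  odd_family B P -> isolated B K -> odd #|K| -> [disjoint K & cover P] ->
  odd_family B (K |: P) /\ #|K |: P| = #|P|.+1.
Proof.
case/odd_familyP=> tP oP iP isoK oddK disK.
have disKP L : L \in P -> [disjoint K & L].
  by move=> LP; apply: disjointWr disK; apply: bigcup_sup.
have KP : K \notin P.
  apply/negP=> /disKP; have [x xK] := odd_block_neq0 oddK.
  by rewrite -setI_eq0 setIid => /eqP/setP/(_ x); rewrite inE xK.
split; last by rewrite cardsU1 KP.
apply/odd_familyP; split=> [|L|L]; last 2 first.
- by rewrite !inE => /predU1P[->|/oP].
- by rewrite !inE => /predU1P[->|/iP].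
apply/trivIsetP=> L M; rewrite !inE.
case/predU1P=> [->|LP] /predU1P[->|MP] //; rewrite ?eqxx // => ne.
- exact: disKP.
- by rewrite disjoint_sym disKP.
- by move/trivIsetP: tP; apply.
Qed.

Lemma odd_familyD B P D :
  odd_family B P -> [disjoint D & cover P] -> odd_family (B :\: D) P.
Proof.
case/odd_familyP=> tP oP iP disD; apply/odd_familyP; split=> // K KP.
have KD : K :\: D = K.
  apply/setDidPl; rewrite disjoint_sym; apply: disjointWr disD.
  exact: bigcup_sup.
by rewrite -{1}KD; apply/isolatedD/iP.
Qed.

(** The uncovered part of [B] is isolated, and odd by the parity hypothesis, so it serves as one
    more block. *)
Lemma odd_family_parity B P :
  odd_family B P -> odd #|B| != odd #|P| ->
  exists2 Q, odd_family B Q & #|Q| = #|P|.+1.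
Proof.
move=> oddP par; have sPB := cover_odd_family oddP.
have oL : odd #|B :\: cover P|.
  move: par; rewrite -(odd_card_cover oddP) -(cardsID (cover P) B).
  by rewrite (setIidPr sPB) oddD; case: (odd #|cover P|); case: (odd #|B :\: _|).
have [] := odd_family_add oddP (isolated_leftover oddP) oL.
  by rewrite -setI_eq0 setDE -setIA [_ :&: cover P]setIC setICr setI0.
by exists ((B :\: cover P) |: P).
Qed.

(** Deleting an uncovered vertex flips the parity, so what is still uncovered becomes an extra odd
    block. *)
Lemma odd_family_saturate B P :
    odd_family B P -> odd #|B| = odd #|P| -> cover P != B ->
  exists2 u, u \in B & exists2 Q, odd_family (B :\ u) Q & #|Q| = #|P|.+1.
Proof.
move=> oddP par neB; have sPB := cover_odd_family oddP.
have /subsetPn[u uB uP] : ~~ (B \subset cover P).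
  by apply: contra neB => sBP; rewrite eqEsubset sPB.
exists u => //; apply: (odd_family_parity (P := P)).
  by apply: odd_familyD; rewrite ?disjoints1.
by move: par; rewrite (cardsD1 u B) uB /= => <-; case: (odd _).
Qed.

(** This adds to an outer barrier one found inside the block [K], at the cost of the single block
    [K]. *)
Lemma odd_family_refine B P K D Q :
    odd_family B P -> K \in P -> D \subset K -> odd_family (K :\: D) Q ->
  odd_family (B :\: D) ((P :\ K) :|: Q) /\ #|(P :\ K) :|: Q|.+1 = #|P| + #|Q|.
Proof.
case/odd_familyP=> tP oP iP KP sDK oddQ.
have sQK := cover_odd_family oddQ.
have [tQ oQ iQ] := odd_familyP _ _ oddQ.
have disPK L : L \in P :\ K -> [disjoint L & K].
  by case/setD1P=> ne LP; move/trivIsetP: tP; apply.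
have subQ L : L \in Q -> L \subset K.
  by case/iQ/isolatedP=> sLK _; apply: subset_trans sLK (subsetDl _ _).
have disPQ L M : L \in P :\ K -> M \in Q -> [disjoint L & M].
  by move=> LP MQ; apply: disjointWr (subQ M MQ) (disPK L LP).
split.
  apply/odd_familyP; split=> [|L|L].
  - apply/trivIsetP=> L M /setUP[LP|LQ] /setUP[MP|MQ] ne.
    + by move/trivIsetP: tP; apply=> //; [case/setD1P: LP | case/setD1P: MP].
    + exact: disPQ.
    + by rewrite disjoint_sym disPQ.
    + by move/trivIsetP: tQ; apply.
  - by case/setUP=> [/setD1P[_ /oP]|/oQ].
  - case/setUP=> [LP|/iQ iL]; last exact: isolated_trans (iP K KP) iL.
    have LD : L :\: D = L by apply/setDidPl/(disjointWr sDK)/disPK.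
    have /setD1P[_ /iP iL] := LP.
    by rewrite -LD; apply: isolatedD.
have := cardsUI (P :\ K) Q; have -> : (P :\ K) :&: Q = set0.
  apply/setP=> L; rewrite in_set0; apply/negP=> /setIP[LP LQ].
  have [x xL] := odd_block_neq0 (oQ L LQ).
  by have /disjoint_setI0/setP/(_ x) := disPQ L L LP LQ; rewrite !inE xL.
by rewrite cards0 addn0 => ->; rewrite (cardsD1 K P) KP add1n addSn.
Qed.

(** The easy half of Tutte's theorem: an odd block is not matched within itself, so it has a vertex
    with its partner in [X]. *)
Lemma odd_family_bound B X P :
  matchable B -> odd_family (B :\: X) P -> #|P| <= #|X :&: B|.
Proof.
move=> [f fB] /odd_familyP[tP oP iP].
(* The partner in [X] determines the block, which gives a surjection onto [P] without choosing
   representatives. *)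
have sPX : P \subset [set pblock P (f y) | y in X :&: B].
  apply/subsetP=> K KP; have /isolatedP[/subsetP sKB isoK] := iP K KP.
  have sKB' x : x \in K -> x \in B by move/sKB/setDP=> [].
  case: (boolP [forall x in K, f x \in K]) => [/forall_inP fK|].
    have /matchable_even : matchable K.
      by exists f; apply: pairing_sub fB _ fK; apply/subsetP.
    by rewrite oP.
  rewrite negb_forall_in => /exists_inP[x xK fxK].
  have [fxB axf ffx] := fB x (sKB' x xK).
  apply/imsetP; exists (f x); last by rewrite ffx (def_pblock tP KP).
  rewrite inE fxB andbT; apply: contraNT fxK => fxX.
  by apply: (isoK x); rewrite // inE fxX.
exact: leq_trans (subset_leq_card sPX) (leq_imset_card _ _).
Qed.

(** As [#|A|] is even, [#|A :\: X|] has the parity of [#|X|], so an excess of exactly one leaves an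
    odd remainder to add as a block. *)
Lemma odd_family_even A X P :
    ~~ odd #|A| -> X \subset A -> odd_family (A :\: X) P -> #|X| < #|P| ->
  exists2 Q, odd_family (A :\: X) Q & #|X|.+2 <= #|Q|.
Proof.
move=> evA sXA oP ltXP; case: (ltnP #|X|.+1 #|P|) => [|leP]; first by exists P.
have cA : #|A| = #|X| + #|A :\: X| by rewrite -(cardsID X A) (setIidPr sXA).
have [|Q oQ cQ] := odd_family_parity oP; last by exists Q => //; card_lia.
by apply/eqP; card_lia.
Qed.

(* In the proof below X is a largest subset of A for which equality holds in
   Tutte's condition. *)
Theorem tutte A :
  matchable A \/ exists X P, [/\ X \subset A, odd_family (A :\: X) P & #|X| < #|P|].
Proof.
have [n] := ubnP #|A|; elim: n => // n IHn in A * => ltAn.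
case: (boolP [exists X : {set G}, exists P : {set {set G}},
    [&& X \subset A, odd_family (A :\: X) P & #|X| < #|P|]]).
  by move=> /existsP[X /existsP[P /and3P[sXA oP lt]]]; right; exists X, P.
move=> noviol; left.
have tight X P : X \subset A -> odd_family (A :\: X) P -> #|P| <= #|X|.
  move=> sXA oP; rewrite leqNgt; apply: contra noviol => lt.
  by apply/existsP; exists X; apply/existsP; exists P; rewrite sXA oP.
have odd0 B : odd_family B set0.
  apply/odd_familyP; split=> [|K|K]; rewrite ?inE //.
  by apply/trivIsetP=> K L; rewrite inE.
have evenA : ~~ odd #|A|.
  apply/negP=> oA; have := @tight set0; rewrite setD0 cards0.
  have [] := odd_family_parity (odd0 A); first by rewrite oA cards0.
  by move=> Q oQ cQ /(_ Q (sub0set _) oQ); rewrite cQ.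
pose good (XP : {set G} * {set {set G}}) := [&& XP.1 \subset A, odd_family (A :\: XP.1) XP.2
                  & #|XP.1| <= #|XP.2|].
have good0 : good (set0, set0) by rewrite /good /= sub0set odd0 !cards0.
case: (arg_maxnP (fun XP : {set G} * {set {set G}} => #|XP.1|) good0).
case=> X P /and3P[/= sXA oP leXP] maxX; have lePX := tight X P sXA oP.
have {maxX} maxX X' P' : X' \subset A -> odd_family (A :\: X') P' ->
    #|X'| <= #|P'| -> #|X'| <= #|X|.
  by move=> *; apply: (maxX (X', P')); apply/and3P.
have cAX : #|A| = #|X| + #|A :\: X|.
  by rewrite -(cardsID X A) (setIidPr sXA).
have parX : odd #|A :\: X| = odd #|P|.
  have -> : #|P| = #|X| by apply/eqP; rewrite eqn_leq lePX.
  by move: evenA; rewrite cAX oddD; case: (odd #|X|); case: (odd #|_ :\: _|).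
(* Otherwise an uncovered vertex could join [X] and bring one more block, against the choice of
   [X]. *)
have covP : cover P = A :\: X.
  apply/eqP; apply: contraT => /(odd_family_saturate oP parX).
  case=> u /setDP[uA uX] [Q]; rewrite setDDl setUC => oQ cQ.
  have := maxX (u |: X) Q; rewrite subUset sub1set uA sXA.
  by rewrite cardsU1 uX cQ add1n !ltnS leXP ltnn => /(_ isT oQ isT).
have [tP odP iP] := odd_familyP _ _ oP.
have sKA K : K \in P -> K \subset A :\: X by move/iP/isolatedP=> [].
(* Every block is factor-critical: a barrier [X'] of [K :\ u] leaves at least [#|X'| + 2] odd blocks
   by parity, so [X] could be enlarged by [u] and [X']. *)
have matchK K u : K \in P -> u \in K -> matchable (K :\ u).
  move=> KP uK; have cK : #|K| = #|K :\ u|.+1 by rewrite (cardsD1 u) uK.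
  have leKA : #|K| <= #|A|.
    by apply/subset_leq_card/(subset_trans (sKA K KP))/subsetDl.
  have [|//|[X' [P' [sX' oP' lt']]]] := IHn (K :\ u); first by card_lia.
  have [|P2 oP2 le2] := odd_family_even _ sX' oP' lt'.
    by have := odP K KP; rewrite cK /= => ->.
  have /subsetD1P[sX'K uX'] := sX'.
  rewrite setDDl in oP2.
  have sDK : u |: X' \subset K by rewrite subUset sub1set uK.
  have [oP3] := odd_family_refine oP KP sDK oP2.
  have disX : [disjoint X & u |: X'].
    rewrite disjoint_sym; apply: disjointWl sDK _.
    by have /subsetDP[] := sKA K KP.
  have := maxX (X :|: (u |: X')) (P :\ K :|: P2).
  rewrite subUset sXA (subset_trans sDK) ?(subset_trans (sKA K KP)) ?subsetDl //.
  rewrite -setDDl => /(_ isT oP3).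
  have -> : #|X :|: (u |: X')| = #|X| + #|X'|.+1.
    apply/eqP; rewrite -[#|X'|.+1]add1n -[1]/(nat_of_bool true) -uX' -cardsU1.
    by rewrite (leq_card_setU X _).2.
  move=> maxX' cP3; suff: #|X| + #|X'|.+1 <= #|X| by card_lia.
  by apply: maxX'; card_lia.
(* The bipartite graph between [X] and the blocks contracted to points. *)
pose E := [set e : G * {set G} |
  [&& e.1 \in X, e.2 \in P & [exists u in e.2, adj e.1 u]]].
have [F [U [W [/subsetP sFE [inj1 inj2] cov leF]]]] := konig E.
(* Blocks outside [W] have no neighbor in [X :\: U], so they are odd blocks of [A :\: (X :&: U)],
   and there are at most [#|U|] of them. *)
have lePF : #|P| <= #|F|.
  apply: leq_trans leF; rewrite -(cardsID W P).
  have := @tight (X :&: U) (P :\: W).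
  rewrite (subset_trans (subsetIl _ _) sXA) => /(_ isT).
  have -> : odd_family (A :\: (X :&: U)) (P :\: W).
    apply/odd_familyP; split=> [|K /setDP[/odP]|K] //.
      exact: trivIsetS (subsetDl _ _) tP.
    case/setDP=> KP KW; have /isolatedP[/subsetP sKAX isoK] := iP K KP.
    apply/isolatedP; split=> [|x y xK /setDP[yA yXU] axy].
      by apply/subsetP=> x /sKAX; rewrite !inE negb_and => /andP[-> ->].
    case: (boolP (y \in X)) => [yX|yX]; last first.
      by apply: (isoK x); rewrite // inE yX.
    have := cov (y, K); rewrite !inE yX KP /= (negPf KW) orbF.
    move: yXU; rewrite inE yX /= => /negPf-> yE; suff /yE : [exists u in K, adj y u] by [].
    by apply/exists_inP; exists x; rewrite // adj_sym.
  move=> /(_ isT) le1; rewrite addnC leq_add //.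
    exact: leq_trans le1 (subset_leq_card (subsetIr _ _)).
  exact: subset_leq_card (subsetIr _ _).
have FP e : e \in F -> [/\ e.1 \in X, e.2 \in P & exists2 u, u \in e.2 & adj e.1 u].
  by move/sFE; rewrite inE => /and3P[-> -> /exists_inP].
have imX : fst @: F = X.
  apply/eqP; rewrite eqEcard card_in_imset // (leq_trans leXP) // andbT.
  by apply/subsetP=> _ /imsetP[e /FP[? _ _] ->].
have imP : snd @: F = P.
  apply/eqP; rewrite eqEcard card_in_imset // lePF andbT.
  by apply/subsetP=> _ /imsetP[e /FP[_ ? _] ->].
have XK x K : x \in X -> K \in P -> x \notin K.
  by move=> xX /sKA/subsetDP[_]; rewrite disjoint_sym => /disjointFr/(_ xX)->.
(* Each pair of [F] joins a vertex of [X] to a neighbor in its block, and [matchK] matches the rest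
   of that block. *)
have -> : A = \bigcup_(e in F) (e.1 |: e.2).
  apply/setP=> x; apply/idP/bigcupP=> [xA|[e /FP[eX eP _]]].
    case: (boolP (x \in X)) => [|xX].
      by rewrite -imX => /imsetP[e eF ->]; exists e; rewrite // setU11.
    have : x \in cover P by rewrite covP inE xX.
    case/bigcupP=> K; rewrite -imP => /imsetP[e eF ->] xe.
    by exists e; rewrite // inE xe orbT.
  case/setU1P=> [->|]; first exact: (subsetP sXA).
  by move/(subsetP (sKA _ eP))/setDP=> [].
apply: matchable_bigcup => [e e' eF e'F ne|e eF].
  have [eX eP _] := FP e eF; have [e'X e'P _] := FP e' e'F.
  have ne1 : e.1 != e'.1 by apply: contra ne => /eqP/inj1->.
  have ne2 : e.2 != e'.2 by apply: contra ne => /eqP/inj2->.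
  have /disjoint_setI0/setP dis2 : [disjoint e.2 & e'.2].
    by move/trivIsetP: tP; apply.
  rewrite -setI_eq0; apply/eqP/setP=> x; rewrite in_set0; apply/negP.
  case/setIP=> /setU1P[->|xe] /setU1P[eq_x|xe'].
  - by rewrite eq_x eqxx in ne1.
  - by have := XK _ _ eX e'P; rewrite xe'.
  - by have := XK _ _ e'X eP; rewrite -eq_x xe.
  - by have := dis2 x; rewrite !inE xe xe'.
have [eX eP [u ue aeu]] := FP e eF.
have -> : e.1 |: e.2 = [set e.1; u] :|: (e.2 :\ u).
  by rewrite -setUA setD1K.
apply: matchableU; [|exact: matchable_pair|exact: matchK].
rewrite -setI_eq0; apply/eqP/setP=> x; rewrite in_set0; apply/negP.
case/setIP=> /set2P[->|->] /setD1P[] //; last by rewrite eqxx.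
by move=> _; apply/negP/XK.
Qed.

End Matchable.

(** * Matchings as sets of edges, and the implication from small independence number *)

Section MatchingSets.
Variable G : sgraph.
Implicit Types (A B K S T X : {set G}) (P M : {set {set G}}).

Lemma edgesP A (e : {set G}) :
  reflect (exists x y, [/\ x \in A, y \in A, adj x y & e = [set x; y]])
          (e \in edges A).
Proof.
apply: (iffP imset2P) => [[x y xA]|[x [y [xA yA xy ->]]]].
  by rewrite inE => /andP[yA xy] ->; exists x, y.
by exists x y; rewrite // inE yA.
Qed.

Lemma card_edge A (e : {set G}) : e \in edges A -> #|e| = 2.
Proof.
case/edgesP=> x [y [_ _ xy ->]]; rewrite cards2.
by case: eqP xy => // ->; rewrite adj_irrefl.
Qed.

Lemma card_cover_matching A M : matching A M -> #|cover M| = 2 * #|M|.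
Proof.
case/andP=> /subsetP sME tM; have /eqP <- := tM.
by rewrite (eq_bigr (fun=> 2)) => [|e /sME/card_edge]; rewrite // sum_nat_const mulnC.
Qed.

Lemma matchable_cover A M : matching A M -> matchable (cover M).
Proof.
case/andP=> /subsetP sME /trivIsetP tM; apply: matchable_bigcup => [|e] //.
by move/sME/edgesP=> [x [y [_ _ xy ->]]]; apply: matchable_pair.
Qed.

Lemma perfect_matching_matchable A M : perfect_matching A M -> matchable A.
Proof. by case/andP=> mM /eqP <-; apply: matchable_cover mM. Qed.

Lemma matchable_perfect_matching A :
  matchable A -> exists M, perfect_matching A M.
Proof.
case=> f fA; exists [set [set x; f x] | x in A].
apply/andP; split; last first.
  rewrite eqEsubset; apply/andP; split; apply/subsetP=> x.
    case/bigcupP=> _ /imsetP[y yA ->]; have [fy _ _] := fA y yA.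
    by rewrite !inE => /orP[]/eqP->.
  by move=> xA; apply/bigcupP; exists [set x; f x]; [apply: imset_f | rewrite set21].
apply/andP; split.
  apply/subsetP=> _ /imsetP[x xA ->]; have [fx axf _] := fA x xA.
  by apply/edgesP; exists x, (f x).
apply/trivIsetP=> _ _ /imsetP[x xA ->] /imsetP[y yA ->]; apply: contraR.
have [_ _ ffx] := fA x xA; have [_ _ ffy] := fA y yA.
case/pred0Pn=> z /andP[/set2P zx /set2P zy].
have swap t : [set f t; t] = [set t; f t] by rewrite setUC.
have xE : [set x; f x] = [set z; f z] by case: zx => ->; rewrite ?ffx ?swap.
have yE : [set y; f y] = [set z; f z] by case: zy => ->; rewrite ?ffy ?swap.
by rewrite xE yE.
Qed.

Lemma matchingS A M M' : M' \subset M -> matching A M -> matching A M'.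
Proof.
move=> sM /andP[sME tM]; apply/andP; split; first exact: subset_trans sME.
exact: trivIsetS tM.
Qed.

(** A perfect matching of [G[A]] extends to a maximal one, which is maximum and so at least as large
    as a perfect matching of [G - v0]: it misses exactly one vertex. *)
Lemma equimatchable_extend A :
    odd #|G| -> equimatchable G -> factor_critical G -> matchable A ->
  exists2 v, v \notin A & matchable (~: A :\ v).
Proof.
move=> oddG eqG fcG /matchable_perfect_matching[MA /andP[mMA /eqP covMA]].
have mMAT : matching [set: G] MA.
  case/andP: mMA => /subsetP sMA tMA; apply/andP; split=> //.
  apply/subsetP=> e /sMA/edgesP[x [y [_ _ xy ->]]].
  by apply/edgesP; exists x, y.
have [M maxM sMAM] := maxset_exists mMAT.
have [mM geM] := eqG M maxM; have /andP[_ /trivIsetP tM] := mM.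
have /card_gt0P[v0 _] : 0 < #|G| by case: #|_| oddG.
have [M' /andP[mM' /eqP covM']] := fcG v0.
have mM'T : matching [set: G] M'.
  case/andP: mM' => /subsetP sM' tM'; apply/andP; split=> //.
  apply/subsetP=> e /sM'/edgesP[x [y [_ _ xy ->]]].
  by apply/edgesP; exists x, y.
have leM := geM M' mM'T.
have cM := card_cover_matching mM; have cM' := card_cover_matching mM'.
have leG : #|cover M| <= #|G| by apply: max_card.
have : #|~: cover M| == 1.
  rewrite covM' cardsC1 in cM'; rewrite cardsCs setCK.
  by apply/eqP; card_lia.
case/cards1P=> v covM.
have vM : v \notin cover M by rewrite -in_setC covM set11.
have sAM : A \subset cover M.
  apply/subsetP=> x; rewrite -covMA => /bigcupP[e eMA xe].
  by apply/bigcupP; exists e; rewrite // (subsetP sMAM).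
exists v; first by apply: contra vM; apply/subsetP.
have -> : ~: A :\ v = cover (M :\: MA).
  apply/setP=> x; rewrite !inE -in_set1 -covM inE negbK -covMA.
  apply/andP/bigcupP=> [[/bigcupP[e eM xe] xA]|[e /setDP[eM eMA] xe]].
    exists e; rewrite // inE eM andbT; apply: contra xA => eMA.
    by apply/bigcupP; exists e.
  split; first by apply/bigcupP; exists e.
  apply/bigcupP=> -[e' e'MA xe']; have e'M := subsetP sMAM e' e'MA.
  have [eq_e|/(tM _ _ eM e'M)] := eqVneq e e'; first by rewrite eq_e e'MA in eMA.
  by move/disjoint_setI0/setP/(_ x); rewrite !inE xe xe'.
exact: matchable_cover (matchingS (subsetDl _ _) mM).
Qed.

Lemma independentP A :
  reflect {in A &, forall x y, ~~ adj x y} (independent A).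
Proof.
apply: (iffP forall_inP) => [iA x y xA yA|iA x xA].
  by have /forall_inP := iA x xA; apply.
by apply/forall_inP=> y; apply: iA.
Qed.

Lemma independentS A B : A \subset B -> independent B -> independent A.
Proof.
move=> /subsetP sAB /independentP iB.
by apply/independentP=> x y /sAB xB /sAB; apply: iB.
Qed.

Lemma independence_number_leP n :
  reflect (forall A, independent A -> #|A| <= n) (independence_number G <= n).
Proof. exact: bigmax_leqP. Qed.

Lemma unmatched_independent M :
  maximal_matching [set: G] M -> independent (~: cover M).
Proof.
case/maxsetP=> /andP[sME tM] maxM.
apply/independentP=> x y xM yM; apply/negP=> xy.
have eE : [set x; y] \in edges [set: G] by apply/edgesP; exists x, y.
have dis e : e \in M -> [disjoint [set x; y] & e].
  move=> eM; rewrite -setI_eq0; apply/eqP/setP=> z; rewrite in_set0.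
  apply/negP=> /setIP[zxy ze].
  have : z \in cover M by apply/bigcupP; exists e.
  by rewrite !inE in xM yM; case/set2P: zxy => ->; apply/negP.
have eM : [set x; y] |: M = M.
  apply: maxM; last exact: subsetUr.
  apply/andP; split; first by rewrite subUset sub1set eE.
  apply/trivIsetP=> e e' /setU1P[->|eM] /setU1P[->|e'M]; rewrite ?eqxx //.
  - by move=> _; apply: dis.
  - by rewrite disjoint_sym => _; apply: dis.
  - by move/trivIsetP: tM; apply.
move: xM; rewrite inE => /negP[]; apply/bigcupP; exists [set x; y].
  by rewrite -eM setU11.
by rewrite set21.
Qed.

Lemma equimatchable_of_independence :
  odd #|G| -> independence_number G <= 2 -> equimatchable G.
Proof.
move=> oddG /independence_number_leP alpha M maxM.
have mM : matching [set: G] M by apply: maxsetp maxM.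
split=> // M' mM'; have cM := card_cover_matching mM.
have := alpha _ (unmatched_independent maxM); have := cardsC (cover M).
have := card_cover_matching mM'; have leM' : #|cover M'| <= #|G| by apply: max_card.
by move=> *; card_lia.
Qed.

(** Distinct blocks are never joined by an edge, so one vertex from each gives an independent set;
    barriers thus bound the independence number from below. *)
Lemma odd_family_representatives B P :
  odd_family B P -> exists2 T : {set G}, independent T & #|T| = #|P|.
Proof.
move=> /odd_familyP[tP oP iP].
have [->|[K0 K0P]] := set_0Vmem P.
  exists set0; last by rewrite !cards0.
  by apply/independentP=> x y; rewrite inE.
(* A default value for the choice function outside [P]. *)
have [x0 _] := odd_block_neq0 (oP _ K0P).
have /fin_all_exists[r rP] (K : {set G}) : exists x, K \in P -> x \in K.
  case: (boolP (K \in P)) => [/oP/odd_block_neq0[x xK]|_]; last by exists x0.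
  by exists x.
have inj_r K L z : K \in P -> L \in P -> z \in K -> z \in L -> K = L.
  move=> KP LP zK zL; apply: contraTeq zL => ne.
  by have := disjointFr (trivIsetP tP _ _ KP LP ne) zK => ->.
exists (r @: P).
  apply/independentP=> _ _ /imsetP[K KP ->] /imsetP[L LP ->].
  apply/negP=> axy; have /isolatedP[sKB isoK] := iP K KP.
  have /isolatedP[/subsetP sLB _] := iP L LP.
  have rLK := isoK _ _ (rP K KP) (sLB _ (rP L LP)) axy.
  have eq_KL := inj_r _ _ _ KP LP rLK (rP L LP).
  by rewrite eq_KL adj_irrefl in axy.
apply: card_in_imset => K L KP LP eq_r.
by apply: (inj_r _ _ (r K)); rewrite ?rP // eq_r rP.
Qed.

Lemma linked_isolated B K x y :
  isolated B K -> x \in K -> linked B x y -> y \in K.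
Proof.
case/isolatedP=> _ isoK xK /connectP[p].
elim: p x xK => [|z p IHp] x xK /= => [_ -> //|/andP[]].
case/andP=> /andP[xB zB] axz /IHp; apply; exact: isoK axz.
Qed.

(** The form in which connectivity is used throughout: after fewer than [k] deletions, a nonempty
    set without outgoing edges is everything. *)
Lemma k_connected_isolated k S K x :
    k_connected G k -> #|S| < k -> isolated (~: S) K -> x \in K ->
  K = ~: S.
Proof.
move=> [_ conG] ltS isoK xK; have /isolatedP[sK _] := isoK.
apply/eqP; rewrite eqEsubset sK; apply/subsetP=> y yS.
have xS := subsetP sK x xK.
exact: linked_isolated isoK xK (conG S ltS x y xS yS).
Qed.

Lemma factor_critical_of_independence k :
    1 < k -> k_connected G k -> odd #|G| -> independence_number G <= 2 ->
  factor_critical G.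
Proof.
move=> k_gt1 conG oddG /independence_number_leP alpha v.
case: (tutte [set~ v]) => [/matchable_perfect_matching //|[X [P [sX oP ltXP]]]].
have evenv : ~~ odd #|[set~ v]|.
  by rewrite cardsC1; case: #|G| oddG => //= n; rewrite negbK.
have [Q oQ leQ] := odd_family_even evenv sX oP ltXP.
have [T iT cT] := odd_family_representatives oQ.
have leT := alpha T iT.
(* Here [#|X| + 2 <= #|Q| = #|T| <= 2]. *)
have X0 : X = set0 by apply/eqP; rewrite -cards_eq0; apply/eqP; card_lia.
have [_ oddQ isoQ] := odd_familyP _ _ oQ.
have full K : K \in Q -> K = [set~ v].
  move=> KQ; have [x xK] := odd_block_neq0 (oddQ K KQ).
  apply: (k_connected_isolated conG) xK; first by rewrite cards1.
  by have := isoQ K KQ; rewrite X0 setD0.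
have : #|Q| <= #|[set [set~ v]]|.
  by apply/subset_leq_card/subsetP=> K /full->; rewrite inE.
by rewrite cards1 => leQ1; card_lia.
Qed.

End MatchingSets.

(** * Disjoint edges leaving a block, from connectivity *)

Section Blocks.
Variable G : sgraph.
Implicit Types (A B D F K S T X Y : {set G}) (P M : {set {set G}}).

Lemma matchable_independent A : matchable A -> independent A -> A = set0.
Proof.
case=> f fA /independentP iA; apply/setP=> x; rewrite in_set0; apply/negP=> xA.
by have [fx axf _] := fA x xA; have := iA x (f x) xA fx; rewrite axf.
Qed.

Lemma odd_family_imsetD B P D :
    odd_family B P -> {in P, forall K, odd #|K :\: D|} ->
  odd_family (B :\: D) [set K :\: D | K in P] /\
  #|[set K :\: D | K in P]| = #|P|.
Proof.
move=> /odd_familyP[tP oP iP] oPD.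
have meet K L x : K \in P -> L \in P -> x \in K :\: D -> x \in L :\: D -> K = L.
  move=> KP LP /setDP[xK _] /setDP[xL _]; apply: contraTeq xL => ne.
  by have := disjointFr (trivIsetP tP _ _ KP LP ne) xK => ->.
split.
  apply/odd_familyP; split=> [|_ /imsetP[K KP ->]|_ /imsetP[K KP ->]].
  - apply/trivIsetP=> _ _ /imsetP[K KP ->] /imsetP[L LP ->]; apply: contraR.
    by case/pred0Pn=> x /andP[xK xL]; rewrite (meet K L x).
  - exact: oPD.
  - exact/isolatedD/iP.
apply: card_in_imset => K L KP LP eqD.
have [x xK] := odd_block_neq0 (oPD K KP).
by apply: (meet K L x) => //; rewrite -eqD.
Qed.

Lemma exists_subset_card (T : finType) (A : {set T}) n :
  n <= #|A| -> exists2 B : {set T}, B \subset A & #|B| = n.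
Proof.
move=> leA; exists [set x in take n (enum A)].
  by apply/subsetP=> x; rewrite inE => /mem_take; rewrite mem_enum.
rewrite cardsE (card_uniqP _) ?take_uniq ?enum_uniq // size_takel //.
by rewrite -cardE.
Qed.

Lemma matchable_disjoint_pairs (M : {set G * G}) K B :
    disjoint_pairs M -> [disjoint K & B] ->
    (forall e, e \in M -> [/\ e.1 \in K, e.2 \in B & adj e.1 e.2]) ->
  matchable (fst @: M :|: snd @: M).
Proof.
move=> [inj1 inj2] disKB ME.
have neKB x y : x \in K -> y \in B -> x != y.
  by move=> xK yB; apply: contraTneq yB => <-; rewrite (disjointFr disKB).
have -> : fst @: M :|: snd @: M = \bigcup_(e in M) [set e.1; e.2].
  apply/setP=> x; apply/setUP/bigcupP=> [[]/imsetP[e eM ->]|[e eM]].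
  - by exists e; rewrite ?set21.
  - by exists e; rewrite ?set22.
  - by case/set2P=> ->; [left | right]; apply: imset_f.
apply: matchable_bigcup => [e e' eM e'M ne|e /ME[_ _]]; last exact: matchable_pair.
have [e1K e2B _] := ME e eM; have [e1K' e2B' _] := ME e' e'M.
rewrite -setI_eq0; apply/eqP/setP=> x; rewrite in_set0; apply/negP.
case/setIP=> /set2P[]-> /set2P[] eq_x.
- by rewrite (inj1 _ _ eM e'M eq_x) eqxx in ne.
- by have := neKB _ _ e1K e2B'; rewrite eq_x eqxx.
- by have := neKB _ _ e1K' e2B; rewrite eq_x eqxx.
- by rewrite (inj2 _ _ eM e'M eq_x) eqxx in ne.
Qed.

(** If König's theorem gave fewer than [m] edges, the cover and [F] would form a set [D] of fewer
    than [k] vertices that cuts off [K :\: D]. Then nothing else remains, so [Y] lies in [D], which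
    is too small. *)
Lemma k_connected_hits k K F Y m :
    k_connected G k -> isolated (~: Y) K -> F \subset Y -> #|F| + m <= k ->
    m <= #|K| -> k <= #|Y| ->
  exists A B, [/\ A \subset K, B \subset Y :\: F, #|A| = m, #|B| = m
                & matchable (A :|: B)].
Proof.
move=> conG isoK sFY leFm lemK lekY; have /isolatedP[sKY isoK'] := isoK.
have disKY : [disjoint K & Y :\: F].
  by rewrite (disjointWr (subsetDl _ _)) // disjoints_subset.
pose E := [set e : G * G | [&& e.1 \in K, e.2 \in Y :\: F & adj e.1 e.2]].
have [M [U [W [/subsetP sME [inj1 inj2] cov leM]]]] := konig E.
have [lemM|ltMm] := leqP m #|M|.
  have [N /subsetP sNM cN] := exists_subset_card lemM.
  have NE e : e \in N -> [/\ e.1 \in K, e.2 \in Y :\: F & adj e.1 e.2].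
    by move/sNM/sME; rewrite inE => /and3P.
  have injN1 : {in N &, injective fst} by move=> e e' /sNM eN /sNM; apply: inj1.
  have injN2 : {in N &, injective snd} by move=> e e' /sNM eN /sNM; apply: inj2.
  exists (fst @: N), (snd @: N); split; rewrite ?card_in_imset //.
  - by apply/subsetP=> _ /imsetP[e /NE[? _ _] ->].
  - by apply/subsetP=> _ /imsetP[e /NE[_ ? _] ->].
  - exact: matchable_disjoint_pairs disKY NE.
(* [W] may contain vertices of [K]; intersecting it with [Y] keeps [K :&: D] inside [U], so that
   [K :\: D] is nonempty. *)
pose D := F :|: (W :&: Y) :|: U.
have leD : #|D| < k.
  have := leq_card_setU (F :|: (W :&: Y)) U; have := leq_card_setU F (W :&: Y).
  move=> [le1 _] [le2 _]; have le3 := subset_leq_card (subsetIl W Y).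
  by rewrite /D; card_lia.
have sKDU : K :&: D \subset U.
  apply/subsetP=> x /setIP[xK]; have := subsetP sKY x xK.
  rewrite !inE => xY; have /contraNF-> // : x \in F -> x \in Y by apply: (subsetP sFY).
  by rewrite (negPf xY) andbF.
have isoKD : isolated (~: D) (K :\: D).
  apply/isolatedP; split=> [|x y /setDP[xK xD] yD axy].
    by rewrite setDE subsetIr.
  rewrite in_setC in yD; rewrite inE yD /=.
  have [yY|yY] := boolP (y \in Y); last by apply: (isoK' x); rewrite // inE.
  have yF : y \notin F by apply: contra yD; rewrite !inE => ->.
  have := cov (x, y); rewrite !inE xK yF yY axy /= => /(_ isT).
  move: xD yD; rewrite !inE yY andbT; case: (x \in U); rewrite ?orbT //=.
  by case: (y \in W); rewrite ?orbT.
have [x xKD] : exists x, x \in K :\: D.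
  have := cardsID D K; have := subset_leq_card sKDU.
  case: (set_0Vmem (K :\: D)) => [->|[x]]; last by exists x.
  by rewrite cards0 => *; exfalso; card_lia.
have KDE := k_connected_isolated conG leD isoKD xKD.
have sYD : Y \subset D.
  apply/subsetP=> y yY; rewrite -[D]setCK -KDE !inE negb_and.
  by apply/orP; right; apply: contraL yY => /(subsetP sKY); rewrite inE.
by have leYD := subset_leq_card sYD; exfalso; card_lia.
Qed.

End Blocks.

(** * Barriers and tight sets in equimatchable factor-critical graphs *)

Section TightSets.
Variables (G : sgraph) (k : nat).
Hypothesis oddG : odd #|G|.
Hypothesis eqG : equimatchable G.
Hypothesis fcG : factor_critical G.
Hypothesis conG : k_connected G k.
Hypothesis k_ge4 : 4 <= k.
Implicit Types (A B D F K S T X Y : {set G}) (P M : {set {set G}}).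

(** Tutte's condition in [G - v] for a vertex [v] of [Y]. *)
Lemma odd_family_lt_card Y P :
  odd_family (~: Y) P -> Y != set0 -> #|P| < #|Y|.
Proof.
move=> oP /set0Pn[v vY]; have [M /perfect_matching_matchable mM] := fcG v.
have -> : #|Y| = #|Y :&: [set~ v]|.+1 by rewrite (cardsD1 v) vY setDE.
apply: odd_family_bound mM _; congr odd_family: oP.
apply/setP=> x; rewrite !inE andbC; case: eqP => [->|] //=; first by rewrite vY.
Qed.

(* By [equimatchable_extend] all of G - A but one vertex v can be matched, so
   Tutte's condition holds there: the blocks that meet A evenly, except the one
   that contains v, leave odd isolated parts outside A. *)
Lemma matchable_waste A Y P :
    matchable A -> odd_family (~: Y) P -> #|Y| <= #|P|.+1 ->
  #|Y :&: A| <= 2 + #|[set K in P | odd #|K :&: A|]|.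
Proof.
move=> mA oP leYP; have [v vA mB] := equimatchable_extend oddG eqG fcG mA.
have [tP odP _] := odd_familyP _ _ oP.
pose P1 := [set K in P | ~~ odd #|K :&: A| && (v \notin K)].
have sP1 : P1 \subset P by apply/subsetP=> K; rewrite inE => /andP[].
have odP1 : {in P1, forall K, odd #|K :\: (v |: A)|}.
  move=> K; rewrite inE => /and3P[KP evK vK].
  have -> : K :\: (v |: A) = K :\: A.
    apply/setP=> x; rewrite !inE negb_or; case: eqP => [->|] //=.
    by rewrite (negPf vK) andbF.
  by move: (odP K KP) evK; rewrite -(cardsID A K) oddD; case: (odd #|K :&: A|).
have [oQ cQ] := odd_family_imsetD (odd_family_subset sP1 oP) odP1.
have := odd_family_bound mB (X := Y) (P := [set K :\: (v |: A) | K in P1]).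
have -> : (~: A :\ v) :\: Y = ~: Y :\: (v |: A).
  by apply/setP=> x; rewrite !inE negb_or; do !case: (_ \in _); rewrite ?andbF ?andbT.
move=> /(_ oQ); rewrite cQ => leP1.
have leYA : #|Y :&: (~: A :\ v)| + #|Y :&: A| <= #|Y|.
  rewrite -(cardsID A Y) addnC leq_add2l subset_leq_card //.
  by apply/subsetP=> x; rewrite !inE => /and3P[-> _ ->].
have cP : #|P| <= #|[set K in P | odd #|K :&: A|]| + #|P1| + 1.
  have sP : P \subset [set K in P | odd #|K :&: A|] :|: P1 :|: [set pblock P v].
    apply/subsetP=> K KP; rewrite !inE KP /=.
    case: (odd _) => //=; case: (boolP (v \in K)) => //= vK.
    by rewrite (def_pblock tP KP vK).
  apply: leq_trans (subset_leq_card sP) _.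
  rewrite (leq_trans (leq_card_setU _ _)) // cards1 leq_add2r.
  exact: leq_card_setU.
by card_lia.
Qed.

(** The last clause says that [G[Y]] has no two disjoint edges. *)
Definition tight Y : Prop :=
  [/\ independent (~: Y), #|Y| = #|~: Y|.+1
    & forall A, A \subset Y -> matchable A -> #|A| <= 2].

(** If [~: T] were matchable, two of the three vertices of [T] would be matched to each other. So
    Tutte's theorem gives a barrier; with [Y] as large as possible the blocks cover [~: Y], since an
    uncovered vertex could be moved into [Y]. *)
Lemma exists_max_barrier T :
    independent T -> #|T| = 3 ->
  exists Y P, [/\ T \subset Y, odd_family (~: Y) P, cover P = ~: Y
                & #|Y| = #|P|.+1].
Proof.
move=> iT cT; have T0 : T != set0 by rewrite -cards_eq0 cT.
have evT : ~~ odd #|~: T|.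
  by have := cardsC T; rewrite cT => cG; move: oddG; card_lia.
have [X0 [P0 [sX0 oP0 leP0]]] : exists X P,
    [/\ X \subset ~: T, odd_family (~: T :\: X) P & #|X|.+2 <= #|P|].
  case: (tutte (~: T)) => [mT|[X [P [sX oP ltP]]]]; last first.
    by have [Q oQ leQ] := odd_family_even evT sX oP ltP; exists X, Q.
  have [v] := equimatchable_extend oddG eqG fcG mT.
  rewrite setCK in_setC negbK => vT mTv.
  have /(congr1 (fun A : {set G} => #|A|)) : T :\ v = set0.
    apply: matchable_independent mTv _.
    by apply: independentS iT; apply: subsetDl.
  by rewrite cards0; have := cardsD1 v T; rewrite vT cT => *; exfalso; card_lia.
pose good (YP : {set G} * {set {set G}}) := [&& T \subset YP.1,
  odd_family (~: YP.1) YP.2 & #|YP.1| <= #|YP.2|.+1].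
(* Here [#|T :|: X0| <= 3 + #|X0| <= #|P0| + 1]. *)
have good0 : good (T :|: X0, P0).
  rewrite /good /= subsetUl setCU -setDE oP0 /=.
  have [leU _] := leq_card_setU T X0; card_lia.
case: (arg_maxnP (fun YP : {set G} * {set {set G}} => #|YP.1|) good0).
case=> Y P /and3P[/= sTY oP leYP] maxY.
have Y0 : Y != set0.
  by apply: contraNneq T0 => Y0; rewrite -subset0 -Y0.
have ltPY := odd_family_lt_card oP Y0.
have cY : #|Y| = #|P|.+1 by card_lia.
exists Y, P; split=> //; apply/eqP; apply: contraT => neP.
have parP : odd #|~: Y| = odd #|P|.
  have := cardsC Y; rewrite cY => cG; move: oddG; card_lia.
have [u uY [Q oQ cQ]] := odd_family_saturate oP parP neP.
rewrite in_setC in uY.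
have := maxY (u |: Y, Q); rewrite /good /= setCU -setDE setDE setIC -setDE oQ.
rewrite (subset_trans sTY (subsetUr _ _)) cardsU1 uY cQ add1n ltnS leYP.
by rewrite /= /leq /= subSnn => /(_ isT).
Qed.

(** * The shape of the blocks of a maximal barrier *)

Section Barrier.
Variables (Y : {set G}) (P : {set {set G}}).
Hypothesis oP : odd_family (~: Y) P.
Hypothesis covP : cover P = ~: Y.
Hypothesis cY : #|Y| = #|P|.+1.
Hypothesis Y_ge3 : 3 <= #|Y|.

(** The source of the contradictions below, each of which builds such a set with four vertices in
    [Y]. *)
Lemma barrier_waste A :
  matchable A -> {in P, forall K, ~~ odd #|K :&: A|} -> #|Y :&: A| <= 2.
Proof.
move=> mA evA; have := matchable_waste mA oP; rewrite cY leqnn => /(_ isT).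
have -> : [set K in P | odd #|K :&: A|] = set0.
  apply/setP=> K; rewrite !inE; apply/negP=> /andP[KP].
  exact/negP/evA.
by rewrite cards0 addn0.
Qed.

Lemma barrier_subset A : A \subset Y -> matchable A -> #|A| <= 2.
Proof.
move=> sAY mA; rewrite -(setIidPr sAY) barrier_waste // => K KP.
have -> : K :&: A = set0; last by rewrite cards0.
apply/setP=> x; rewrite !inE; apply/negP=> /andP[xK xA].
have : x \in cover P by apply/bigcupP; exists K.
by rewrite covP inE (subsetP sAY).
Qed.

(** Otherwise [~: Y] is connected and can only be a single block, so that [#|Y| <= 2]. *)
Lemma barrier_large : k <= #|Y|.
Proof.
rewrite leqNgt; apply/negP=> ltYk; have [_ odP isoP] := odd_familyP _ _ oP.
have full K : K \in P -> K = ~: Y.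
  move=> KP; have [x xK] := odd_block_neq0 (odP K KP).
  exact: (k_connected_isolated conG) ltYk (isoP K KP) xK.
have : #|P| <= #|[set ~: Y]|.
  by apply/subset_leq_card/subsetP=> K /full->; rewrite inE.
by rewrite cards1 => leP; card_lia.
Qed.

Lemma barrier_hits K F m :
    K \in P -> F \subset Y -> #|F| + m <= k -> m <= #|K| ->
  exists A B, [/\ [/\ A \subset K, B \subset Y :\: F, #|A| = m & #|B| = m],
    matchable (A :|: B)
    & forall L, L \in P -> L :&: (A :|: B) = if L == K then A else set0].
Proof.
move=> KP sFY leF leK; have [tP odP isoP] := odd_familyP _ _ oP.
have [A [B [sA sB cA cB mAB]]] :=
  k_connected_hits conG (isoP K KP) sFY leF leK barrier_large.
exists A, B; split=> // L LP; apply/setP=> x.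
have xLY : x \in L -> x \notin Y.
  by move=> xL; rewrite -in_setC -covP; apply/bigcupP; exists L.
have xBY : x \in B -> x \in Y by move/(subsetP sB)/setDP=> [].
rewrite !inE; case: eqP => [->|/eqP ne].
  case: (boolP (x \in A)) => [/(subsetP sA)-> //|_] /=.
  apply/negP=> /andP[xK /xBY]; apply/negP; rewrite -in_setC -covP.
  by apply/bigcupP; exists K.
rewrite inE; apply/negP=> /andP[xL] /orP[/(subsetP sA) xK|/xBY]; last exact/negP/xLY.
by have := disjointFr (trivIsetP tP _ _ LP KP ne) xL; rewrite xK.
Qed.

Lemma barrier_extend K D m :
    K \in P -> matchable D -> {in P, forall L, ~~ odd #|L :&: D|} ->
    [disjoint K & D] -> #|Y :&: D| + m <= k -> m <= #|K| -> ~~ odd m ->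
  exists D', [/\ matchable D', {in P, forall L, ~~ odd #|L :&: D'|},
    D' \subset Y :|: D :|: K & #|Y :&: D'| = #|Y :&: D| + m].
Proof.
move=> KP mD evD disKD leD leK evm.
have [A [B [[sA sB cA cB] mAB meet]]] := barrier_hits KP (subsetIl Y D) leD leK.
have sBY : B \subset Y by apply: subset_trans sB (subsetDl _ _).
have disBD : [disjoint D & B].
  rewrite -setI_eq0; apply/eqP/setP=> x; rewrite in_set0; apply/negP.
  by case/setIP=> xD /(subsetP sB); rewrite !inE xD andbT; case: (x \in Y).
have disAY : Y :&: A = set0.
  apply/setP=> x; rewrite !inE; apply/negP=> /andP[xY /(subsetP sA) xK].
  have : x \in ~: Y by rewrite -covP; apply/bigcupP; exists K.
  by rewrite inE xY.
have disD : [disjoint D & A :|: B].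
  rewrite -setI_eq0 setIUr (disjoint_setI0 disBD) setU0 setI_eq0.
  by rewrite disjoint_sym (disjointWl sA).
exists (D :|: (A :|: B)); split.
- exact: matchableU.
- move=> L LP; rewrite setIUr meet //; case: eqP => [->|_].
    by rewrite (disjoint_setI0 disKD) set0U cA.
  by rewrite setU0 evD.
- rewrite !subUset; apply/and3P; split; apply/subsetP=> x xS; rewrite !inE.
  + by rewrite xS orbT.
  + by rewrite (subsetP sA x xS) orbT.
  + by rewrite (subsetP sBY x xS).
- rewrite !setIUr disAY set0U (setIidPr sBY) -cB; apply/eqP.
  rewrite (leq_card_setU (Y :&: D) B).2.
  exact: disjointWl (subsetIr _ _) disBD.
Qed.

(** Four disjoint edges from [K] to [Y], available as [4 <= k], would waste four vertices of [Y]. *)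
Lemma barrier_block_le3 K : K \in P -> #|K| <= 3.
Proof.
move=> KP; rewrite leqNgt; apply/negP=> ltK.
have [|||||D [mD evD _ cD]] := @barrier_extend K set0 4 KP (matchable0 G) => //.
- by move=> L _; rewrite setI0 cards0.
- by rewrite -setI_eq0 setI0.
- by rewrite setI0 cards0.
by have := barrier_waste mD evD; rewrite cD addnC.
Qed.

(** Two edges from each of two distinct blocks would again waste four vertices of [Y]. *)
Lemma barrier_block_uniq K L :
  K \in P -> L \in P -> 2 <= #|K| -> 2 <= #|L| -> K = L.
Proof.
move=> KP LP leK leL; have [tP _ _] := odd_familyP _ _ oP.
apply: contraTeq isT => ne.
have [|||||D [mD evD sD cD]] := @barrier_extend K set0 2 KP (matchable0 G) => //.
- by move=> M _; rewrite setI0 cards0.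
- by rewrite -setI_eq0 setI0.
- by rewrite setI0 cards0; card_lia.
rewrite setI0 cards0 setU0 in sD cD.
have disLD : [disjoint L & D].
  rewrite -setI_eq0; apply/eqP/setP=> x; rewrite in_set0; apply/negP.
  case/setIP=> xL /(subsetP sD)/setUP[xY|xK].
    have : x \in ~: Y by rewrite -covP; apply/bigcupP; exists L.
    by rewrite inE xY.
  by have := disjointFr (trivIsetP tP _ _ KP LP ne) xK; rewrite xL.
have [|||D' [mD' evD' _ cD']] := @barrier_extend L D 2 LP mD evD disLD => //.
- by rewrite cD.
by have := barrier_waste mD' evD'; rewrite cD' cD.
Qed.

(** An edge inside [Y] and two edges from [K] would waste four vertices of [Y]. *)
Lemma barrier_independent K : K \in P -> 2 <= #|K| -> independent Y.
Proof.
move=> KP leK; apply/independentP=> x y xY yY; apply/negP=> axy.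
have neK z : z \in Y -> forall L, L \in P -> z \notin L.
  move=> zY L LP; apply/negP=> zL; have : z \in ~: Y.
    by rewrite -covP; apply/bigcupP; exists L.
  by rewrite inE zY.
have disP L : L \in P -> L :&: [set x; y] = set0.
  move=> LP; apply/setP=> z; rewrite in_set0; apply/negP=> /setIP[zL].
  by case/set2P=> eq_z; rewrite eq_z in zL; [have := neK x xY L LP | have := neK y yY L LP];
    rewrite zL.
have sxy : [set x; y] \subset Y by rewrite subUset !sub1set xY.
have cxy : #|[set x; y]| = 2.
  by rewrite cards2; case: eqP axy => // ->; rewrite adj_irrefl.
have [|||||D [mD evD _ cD]] :=
  @barrier_extend K [set x; y] 2 KP (matchable_pair axy) => //.
- by move=> L LP; rewrite disP ?cards0.
- by rewrite -setI_eq0 disP.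
- by rewrite (setIidPr sxy) cxy.
by have := barrier_waste mD evD; rewrite cD (setIidPr sxy) cxy.
Qed.

End Barrier.

(* Either all the odd blocks are singletons, or exactly one has three elements
   and then Y is independent and its complement is tight. *)
Lemma exists_tight T :
    independent T -> #|T| = 3 ->
  exists2 Y, tight Y & (T \subset Y) || (T \subset ~: Y).
Proof.
move=> iT cT; have [Y [P [sTY oP covP cY]]] := exists_max_barrier iT cT.
have Y3 : 3 <= #|Y| by rewrite -cT subset_leq_card.
have [tP odP isoP] := odd_familyP _ _ oP.
have sumP : \sum_(K in P) #|K| = #|~: Y| by rewrite -covP; apply/eqP.
have inP x : x \notin Y -> exists2 K, K \in P & x \in K.
  by rewrite -in_setC -covP => /bigcupP[K]; exists K.
have stayP x y K : K \in P -> x \in K -> y \notin Y -> adj x y -> [set x; y] \subset K.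
  move=> KP xK yY axy; have /isolatedP[_ isoK] := isoP K KP.
  by rewrite subUset !sub1set xK (isoK x) // inE.
have pair2 x y K : adj x y -> [set x; y] \subset K -> 2 <= #|K|.
  move=> axy /subset_leq_card; rewrite cards2.
  by case: eqP axy => // ->; rewrite adj_irrefl.
have [/exists_inP[K KP leK]|] := boolP [exists K in P, 2 <= #|K|].
  have iY := barrier_independent oP covP cY Y3 KP leK.
  exists (~: Y); last by rewrite setCK sTY orbT.
  have le3 := barrier_block_le3 oP covP cY Y3 KP.
  have uniqK L : L \in P -> 2 <= #|L| -> L = K.
    by move=> LP leL; apply: (barrier_block_uniq oP covP cY Y3).
  have cK : #|K| = 3.
    by move: (odP K KP) le3 leK; case: #|K| => [|[|[|[|]]]].
  split; rewrite ?setCK //.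
    (* All other blocks are singletons, so [#|~: Y| = #|P| + 2 = #|Y| + 1]. *)
    have : \sum_(L in P :\ K) #|L| = #|P :\ K|.
      rewrite -sum1_card; apply: eq_bigr => L /setD1P[ne LP].
      have := odP L LP; case: (leqP 2 #|L|) => [/(uniqK L LP) eq_L|].
        by rewrite eq_L eqxx in ne.
      by case: #|L| => [|[|]].
    have := cardsD1 K P; rewrite KP; move: sumP; rewrite (big_setD1 K KP) /=.
    by rewrite cK => *; card_lia.
  move=> A sA mA; have [f fA] := mA.
  (* Edges outside [Y] stay within one block, and only [K] has room for an edge; parity then leaves
     at most two of its three vertices. *)
  have sAK : A \subset K.
    apply/subsetP=> x xA; have [fx axf _] := fA x xA.
    have xY : x \notin Y by rewrite -in_setC (subsetP sA).
    have fxY : f x \notin Y by rewrite -in_setC (subsetP sA).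
    have [L LP xL] := inP x xY; have sL := stayP _ _ _ LP xL fxY axf.
    by rewrite -(uniqK L LP (pair2 _ _ _ axf sL)).
  have := subset_leq_card sAK; have := matchable_even mA; rewrite cK.
  by case: #|A| => [|[|[|[|]]]].
rewrite negb_exists_in => /forall_inP lt2; exists Y; last by rewrite sTY.
split; last exact: (barrier_subset oP covP cY).
  apply/independentP=> x y; rewrite !inE => xY yY; apply/negP=> axy.
  have [K KP xK] := inP x xY; have sK := stayP _ _ _ KP xK yY axy.
  by have := lt2 K KP; rewrite (pair2 _ _ _ axy sK).
rewrite cY -sumP -sum1_card; congr _.+1; apply: eq_bigr => K KP.
by have := lt2 K KP; have := odP K KP; case: #|K| => [|[|]].
Qed.

(** * Comparison of tight sets, and centers *)

Lemma tight_edges Y a b u v :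
    tight Y -> a \in Y -> b \in Y -> u \in Y -> v \in Y ->
    adj a b -> adj u v -> ~~ [disjoint [set a; b] & [set u; v]].
Proof.
move=> [_ _ le2] aY bY uY vY ab uv; apply/negP=> dis.
have := le2 _ _ (matchableU dis (matchable_pair ab) (matchable_pair uv)).
rewrite !subUset !sub1set aY bY uY vY => /(_ isT).
rewrite (eqP (etrans (leq_card_setU _ _).2 dis)) !cards2.
by case: eqP ab => [->|_ _]; case: eqP uv => [->|_ _]; rewrite ?adj_irrefl.
Qed.

(** The edges of [G[Y]] that cross [D] form a bipartite graph without two disjoint edges, so König's
    theorem covers them by one vertex. *)
Lemma tight_cut_cover Y D :
    tight Y -> exists2 U : {set G}, #|U| <= 1 &
  forall x y, x \in Y :&: D -> y \in Y :\: D -> adj x y -> (x \in U) || (y \in U).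
Proof.
move=> [_ _ le2].
pose E := [set e : G * G | [&& e.1 \in Y :&: D, e.2 \in Y :\: D & adj e.1 e.2]].
have [M [U [W [/subsetP sME dM cov leM]]]] := konig E.
have ME e : e \in M -> [/\ e.1 \in Y :&: D, e.2 \in Y :\: D & adj e.1 e.2].
  by move/sME; rewrite inE => /and3P.
have disD : [disjoint Y :&: D & Y :\: D].
  by rewrite -setI_eq0 setDE setIACA setICr setI0.
have mM := matchable_disjoint_pairs dM disD ME; have [inj1 inj2] := dM.
have s1 : fst @: M \subset Y :&: D by apply/subsetP=> _ /imsetP[e /ME[? _ _] ->].
have s2 : snd @: M \subset Y :\: D by apply/subsetP=> _ /imsetP[e /ME[_ ? _] ->].
have := le2 _ _ mM; rewrite subUset (subset_trans s1 (subsetIl _ _)).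
rewrite (subset_trans s2 (subsetDl _ _)) => /(_ isT).
have dis12 : [disjoint fst @: M & snd @: M].
  exact: disjointWl s1 (disjointWr s2 disD).
rewrite (eqP (etrans (leq_card_setU _ _).2 dis12)) !card_in_imset // => leM2.
exists (U :|: W).
  by have [leU _] := leq_card_setU U W; card_lia.
move=> x y xD yD axy; have := cov (x, y); rewrite inE /= xD yD axy => /(_ isT).
by rewrite !inE => /orP[]->; rewrite ?orbT.
Qed.

(** An edge between agreement and disagreement lies in [Y] crossing [Y'], or in [Y'] crossing [Y],
    since both complements are independent. Two vertices cover all these edges, so by connectivity
    they contain one of the two sets. *)
Lemma tight_agree Y Y' :
  tight Y -> tight Y' ->
  #|[set x | (x \in Y) == (x \in Y')]| <= 2 \/
  #|[set x | (x \in Y) != (x \in Y')]| <= 2.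
Proof.
move=> tY tY'; set A1 := [set x | _ == _]; set A2 := [set x | _ != _].
have [U cU covU] := tight_cut_cover Y' tY; have [U' cU' covU'] := tight_cut_cover Y tY'.
have [/independentP iY _ _] := tY; have [/independentP iY' _ _] := tY'.
have leS : #|U :|: U'| <= 2 by have [le _] := leq_card_setU U U'; card_lia.
have isoA : isolated (~: (U :|: U')) (A1 :\: (U :|: U')).
  apply/isolatedP; split=> [|x y /setDP[xA xS]]; first by rewrite setDE subsetIr.
  rewrite inE => yS axy; rewrite inE yS inE /=; apply/negPn/negP=> yA.
  rewrite inE in xA; have [xU xU'] : x \notin U /\ x \notin U'.
    by apply/andP; rewrite -negb_or -in_setU.
  have [yU yU'] : y \notin U /\ y \notin U' by apply/andP; rewrite -negb_or -in_setU.
  have c1 := covU x y; have c2 := covU' x y.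
  have c3 := iY x y; have c4 := iY' x y.
  rewrite !inE (negPf xU) (negPf yU) (negPf xU') (negPf yU') axy in c1 c2 c3 c4.
  case: (x \in Y) (x \in Y') (y \in Y) (y \in Y') c1 c2 c3 c4 xA yA
    => [] [] [] [] //= c1 c2 c3 c4 _ _; move: c1 c2 c3 c4;
    by do ?[by move=> /(_ isT isT isT) | by move=> /(_ isT isT) | move=> _].
have [A0|[x xA]] := set_0Vmem (A1 :\: (U :|: U')).
  left; apply: leq_trans leS; apply: subset_leq_card.
  by rewrite -setD_eq0 A0.
right; have AE : A1 :\: (U :|: U') = ~: (U :|: U').
  by apply: (k_connected_isolated conG) isoA xA; card_lia.
apply: leq_trans leS; apply/subset_leq_card/subsetP=> y yA.
apply: contraLR yA; rewrite -in_setC -AE => /setDP[yA _].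
by rewrite inE in yA; rewrite inE yA.
Qed.

Lemma k_connected_degree (x : G) : k <= #|[set y | adj x y]|.
Proof.
rewrite leqNgt; apply/negP=> lt; have [ltkG _] := conG.
have isox : isolated (~: [set y | adj x y]) [set x].
  apply/isolatedP; split; first by rewrite sub1set !inE adj_irrefl.
  by move=> _ y /set1P->; rewrite !inE => /negPf->.
have := k_connected_isolated conG lt isox (set11 x) => /(congr1 (fun A : {set G} => #|A|)).
by rewrite cards1 cardsCs setCK => *; card_lia.
Qed.

(** The independent triple [y], [z], [z'] lies on one side of another tight set [Y'], which is
    compared with [Y]. *)
Lemma tight_two_nonneighbors Y y z z' :
    tight Y -> y \in Y -> z \notin Y -> z' \notin Y -> z != z' ->
    ~~ adj y z -> ~~ adj y z' ->
  independent (Y :\ y).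
Proof.
move=> tY yY zY z'Y ne yz yz'; have [/independentP iY cY _] := tY.
have zz' : ~~ adj z z' by apply: iY; rewrite inE.
have nez : y != z by apply: contraTneq yY => ->.
have nez' : y != z' by apply: contraTneq yY => ->.
have iT : independent [set y; z; z'].
  apply/independentP=> u v; rewrite !inE -!orbA.
  by move=> /or3P[]/eqP-> /or3P[]/eqP->; rewrite ?adj_irrefl // adj_sym.
have cT : #|[set y; z; z']| = 3.
  by rewrite -setUA cardsU1 cards2 !inE negb_or nez nez' ne.
have [Y' tY'] := exists_tight iT cT; have [/independentP iY' cY' _] := tY'.
have A1E : #|[set x | (x \in Y) == (x \in Y')]| = #|Y :&: Y'| + #|~: Y :\: Y'|.
  rewrite -(cardsID Y); congr (_ + _); apply: eq_card => x; rewrite !inE;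
  by do 2!case: (x \in _).
have A2E : #|[set x | (x \in Y) != (x \in Y')]| = #|Y :\: Y'| + #|~: Y :&: Y'|.
  rewrite -(cardsID Y); congr (_ + _); apply: eq_card => x; rewrite !inE;
  by do 2!case: (x \in _).
have c1 := cardsID Y' Y; have c2 := cardsID Y' (~: Y).
have c3 : #|Y :&: Y'| + #|~: Y :&: Y'| = #|Y'|.
  by rewrite -(cardsID Y Y') [Y' :&: Y]setIC [Y' :\: Y]setDE [Y' :&: ~: Y]setIC.
have c4 := cardsC Y; have c5 := cardsC Y'.
have pair2 B : z \in B -> z' \in B -> 2 <= #|B|.
  move=> zB z'B; have := cards2 z z'; rewrite ne => <-.
  by apply: subset_leq_card; rewrite subUset !sub1set zB.
rewrite !subUset !sub1set !inE => /orP[/andP[/andP[yY' zY'] z'Y']|/andP[/andP[yY' zY'] z'Y']].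
  have le2 : 2 <= #|~: Y :&: Y'| by apply: pair2; rewrite !inE ?zY ?z'Y.
  (* Disagreement has [2 * #|~: Y :&: Y'| >= 4] elements, so agreement is the small set, and its
     size is [2 * #|Y :&: Y'| - 1]. *)
  have cI : #|Y :&: Y'| = 1.
    by case: (tight_agree tY tY'); rewrite ?A1E ?A2E => *; card_lia.
  apply: independentS (_ : _ \subset ~: Y') _; last by case: tY'.
  apply/subsetP=> x /setD1P[neq xY]; rewrite inE; apply/negP=> xY'.
  have : [set x; y] \subset Y :&: Y' by rewrite subUset !sub1set !inE xY xY' yY.
  by move/subset_leq_card; rewrite cards2 neq cI.
have le2 : 2 <= #|~: Y :\: Y'| by apply: pair2; rewrite !inE ?zY ?z'Y ?zY' ?z'Y'.
have le1 : 0 < #|Y :\: Y'| by apply/card_gt0P; exists y; rewrite inE yY'.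
(* Now agreement is large, and disagreement is nonempty of size [2 * #|~: Y :&: Y'|]. *)
have cD : #|~: Y :&: Y'| = 1.
  by case: (tight_agree tY tY'); rewrite ?A1E ?A2E => *; card_lia.
apply/independentP=> u v /setD1P[neu uY] /setD1P[nev vY]; apply/negP=> uv.
have sN : [set t | adj y t] \subset ([set t | adj y t] :&: Y) :|: (~: Y :&: Y').
  apply/subsetP=> t; rewrite !inE => yt; rewrite yt /=.
  case: (t \in Y) => //=; apply/negPn/negP=> tY'0.
  by have := iY' y t; rewrite !inE yt => /(_ yY' tY'0).
(* All neighbors of [y] are in [Y'], and a single vertex of [Y'] is outside [Y]. One of these three
   neighbors avoids [u] and [v], giving an edge disjoint from [uv]. *)
have : 3 <= #|[set t | adj y t] :&: Y|.
  have := subset_leq_card sN.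
  have [le _] := leq_card_setU ([set t | adj y t] :&: Y) (~: Y :&: Y').
  by have := k_connected_degree y => *; card_lia.
move=> le3; have /subsetPn[t] : ~~ ([set t | adj y t] :&: Y \subset [set u; v]).
  apply/negP=> /subset_leq_card; rewrite cards2 => *.
  by case: (u != v) => *; card_lia.
rewrite !inE => /andP[yt tYY] /norP[tu tv].
have /negP[] := tight_edges tY yY tYY uY vY yt uv.
rewrite -setI_eq0; apply/eqP/setP=> x; rewrite !inE; apply/negP.
by case/andP=> /orP[]/eqP-> /orP[]/eqP eq_x; move: neu nev tu tv; rewrite eq_x eqxx.
Qed.

Definition center Y (c : G) : Prop :=
  forall y z z', y \in Y :\ c -> z \notin Y -> z' \notin Y ->
    ~~ adj y z -> ~~ adj y z' -> z = z'.

Lemma tight_center Y c :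
  tight Y -> {in Y :\ c, forall y, ~~ independent (Y :\ y)} -> center Y c.
Proof.
move=> tY depY y z z' yYc zY z'Y yz yz'; apply/eqP.
apply: contraNT (depY y yYc) => ne; have /setD1P[_ yY] := yYc.
exact: tight_two_nonneighbors ne yz yz'.
Qed.

Lemma adj_setD1_dependent Y x y w :
  adj x w -> x \in Y -> w \in Y -> x != y -> w != y -> ~~ independent (Y :\ y).
Proof.
move=> xw xY wY xy wy; apply/negP=> /independentP/(_ x w).
by rewrite !inE xY wY xy wy xw => /(_ isT isT).
Qed.

(** Every edge inside the new set passes through [c], because [~: Y] is independent. *)
Lemma tight_swap Y c :
  tight Y -> c \in Y -> independent (Y :\ c) -> tight (c |: ~: Y).
Proof.
move=> [/independentP iY cY _] cinY iYc.
have E : ~: (c |: ~: Y) = Y :\ c by rewrite setCU setCK setDE setIC.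
split; rewrite ?E //.
  by rewrite cardsU1 inE cinY add1n -cY (cardsD1 c) cinY.
move=> A sA mA; have [f fA] := mA.
have fc x : x \in A -> x != c -> f x = c.
  move=> xA xc; have [fx axf _] := fA x xA.
  have := subsetP sA x xA; have := subsetP sA _ fx.
  rewrite !inE (negPf xc) /=; case: eqP => //= _ fxY xY.
  by have := iY x (f x); rewrite !inE axf => /(_ xY fxY).
have sAc : A \subset [set c; f c].
  apply/subsetP=> x xA; rewrite !inE; case: eqP => //= /eqP xc.
  by have [_ _ <-] := fA x xA; rewrite (fc x) // eqxx.
apply: leq_trans (subset_leq_card sAc) _; rewrite cards2.
by case: (_ != _).
Qed.

(** If at most one vertex [c] of [Y] has [Y :\ c] independent, it is a center of [Y], and any vertex
    is one if there is none. If there is a second such vertex [y], then swapping makes [c] a center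
    of [c |: ~: Y]. *)
Lemma exists_center T :
  independent T -> #|T| = 3 ->
  exists Y c, [/\ tight Y, c \in Y & center Y c].
Proof.
move=> iT cT; have [Y tY _] := exists_tight iT cT.
have [/exists_inP[c cY iYc]|] := boolP [exists c in Y, independent (Y :\ c)]; last first.
  rewrite negb_exists_in => /forall_inP depY.
  have [_ cY _] := tY; have /card_gt0P[c cinY] : 0 < #|Y| by rewrite cY.
  by exists Y, c; split=> //; apply: tight_center => // y /setD1P[_]; apply: depY.
have [/exists_inP[y yYc iYy]|] := boolP [exists y in Y :\ c, independent (Y :\ y)]; last first.
  rewrite negb_exists_in => /forall_inP depY.
  by exists Y, c; split=> //; apply: tight_center.
have tY' := tight_swap tY cY iYc.
exists (c |: ~: Y), c; split; rewrite ?setU11 //.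
apply: tight_center => // y' /setD1P[y'c _].
have /setD1P[yc yY] := yYc.
(* A neighbor [w] of [c] other than [y] is outside [Y], as [Y :\ y] is independent; so the edge [cw]
   lies in the swapped set and avoids [y']. *)
have /subsetPn[w] : ~~ ([set t | adj c t] \subset [set y; y']).
  apply/negP=> /subset_leq_card; rewrite cards2; have := k_connected_degree c.
  by case: (y != y') => *; card_lia.
rewrite !inE => cw /norP[wy wy'].
apply: (adj_setD1_dependent cw _ _ _ wy'); rewrite ?setU11 // 1?eq_sym //.
rewrite !inE; apply/orP; right; apply/negP=> wY.
have cy : c != y by rewrite eq_sym.
by have := adj_setD1_dependent cw cY wY cy wy; rewrite iYy.
Qed.

(** * A tight set with a center against the cut [S] *)

Section Separation.
Variables (Y S : {set G}) (c : G).
Hypothesis tY : tight Y.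
Hypothesis cY : c \in Y.
Hypothesis centerY : center Y c.
Hypothesis cS : #|S| = k.
Hypothesis G_large : 2 * k + 3 <= #|G|.

Definition separates (C W : {set G}) : Prop :=
  [/\ [disjoint C & W], C :|: W = ~: S
    & forall x y, x \in C -> y \in W -> ~~ adj x y].

Lemma separates_sym C W : separates C W -> separates W C.
Proof.
case=> disCW CW nadj; split; rewrite 1?disjoint_sym 1?setUC // => x y xW yC.
by rewrite adj_sym nadj.
Qed.

Lemma card_tight : #|G| = (2 * #|~: Y|).+1.
Proof. by have [_ cYE _] := tY; have := cardsC Y; card_lia. Qed.

(** Otherwise [C] has two vertices outside [Y]. A vertex of [Y :\ c] in [W] would miss both, so
    [Y :\ c] lies in [S] and [#|G| <= 2 * k + 1]. *)
Lemma separated_meets C W :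
  separates C W -> 3 <= #|C| -> exists2 y, y \in Y :\ c & y \in C.
Proof.
move=> [disCW CW nadj] leC; apply/exists_inP; apply: contraT.
rewrite negb_exists_in => /forall_inP noC.
have : 2 <= #|C :\: Y|.
  have := cardsID Y C; have : #|C :&: Y| <= #|[set c]|.
    apply/subset_leq_card/subsetP=> y /setIP[yC yY]; rewrite inE.
    by apply: contraTT yC => yc; apply: noC; rewrite !inE yc.
  by rewrite cards1 => *; card_lia.
case/card_gt1P=> z [z' [/setDP[zC zY] /setDP[z'C z'Y] ne]].
have noW y : y \in Y :\ c -> y \notin W.
  move=> yYc; apply: contra ne => yW; apply/eqP/(centerY yYc) => //.
    by rewrite adj_sym nadj.
  by rewrite adj_sym nadj.
have : #|Y :\ c| <= #|S|.
  apply/subset_leq_card/subsetP=> y yYc; rewrite -[S]setCK -CW !inE negb_or.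
  by rewrite noC ?noW.
have := cardsD1 c Y; have := card_tight; have [_ cYE _] := tY.
by rewrite cY => *; exfalso; card_lia.
Qed.

(** Some vertex of [Y :\ c] is in [W] and misses all of [C]. *)
Lemma separated_outside C W z z' :
  separates C W -> 3 <= #|W| -> z \in C :\: Y -> z' \in C :\: Y -> z = z'.
Proof.
move=> sepCW leW /setDP[zC zY] /setDP[z'C z'Y].
have [y yYc yW] := separated_meets (separates_sym sepCW) leW.
have [_ _ nadj] := sepCW.
by apply: (centerY yYc); rewrite // adj_sym nadj.
Qed.

Lemma neighbors_outside z : z \notin Y -> [set t | adj z t] \subset Y.
Proof.
move=> zY; apply/subsetP=> t; rewrite inE; apply: contraLR => tY'.
by have [/independentP iY _ _] := tY; apply: iY; rewrite inE.
Qed.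

(** For [z] and [z'] outside [Y] on the two sides, the neighborhoods lie in [Y] and share only
    vertices of [S], so [2 * k <= #|Y| + #|S :&: Y|]. But [#|Y| <= #|S :\: Y| + 3], whence
    [k <= 3]. *)
Lemma separated_both C W :
  separates C W -> 3 <= #|C| -> 3 <= #|W| -> C :\: Y != set0 -> W :\: Y = set0.
Proof.
move=> sepCW leC leW /set0Pn[z zCY]; have [_ CW nadj] := sepCW.
apply/setP=> z'; rewrite in_set0; apply/negP=> z'WY.
have /setDP[zC zY] := zCY; have /setDP[z'W z'Y] := z'WY.
have d1 : k <= #|Y :\: W|.
  apply: leq_trans (k_connected_degree z) (subset_leq_card _).
  apply/subsetP=> t zt; have tYY := subsetP (neighbors_outside zY) t zt.
  rewrite inE tYY andbT; apply/negP=> tW; have := nadj z t zC tW.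
  by rewrite inE in zt; rewrite zt.
have d2 : k <= #|Y :\: C|.
  apply: leq_trans (k_connected_degree z') (subset_leq_card _).
  apply/subsetP=> t zt; have tYY := subsetP (neighbors_outside z'Y) t zt.
  rewrite inE tYY andbT; apply/negP=> tC; have := nadj t z' tC z'W.
  by rewrite inE adj_sym in zt; rewrite zt.
have leU : #|(Y :\: W) :|: (Y :\: C)| <= #|Y|.
  by apply: subset_leq_card; rewrite subUset !subsetDl.
have leI : #|(Y :\: W) :&: (Y :\: C)| <= #|S :&: Y|.
  apply/subset_leq_card/subsetP=> t; rewrite -[S]setCK -CW !inE negb_or.
  by case/andP=> /andP[-> ->] /andP[-> _].
have leZ : #|~: Y| <= #|S :\: Y| + 2.
  have sZ : ~: Y \subset (S :\: Y) :|: [set z; z'].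
    apply/subsetP=> t; rewrite !inE => tYn; rewrite tYn /=.
    have [//|tS] := boolP (t \in S) => /=.
    have : t \in C :|: W by rewrite CW inE.
    case/setUP=> [tC|tW].
      have tCY : t \in C :\: Y by rewrite inE tYn.
      by rewrite (separated_outside sepCW leW tCY zCY) eqxx.
    have tWY : t \in W :\: Y by rewrite inE tYn.
    rewrite (separated_outside (separates_sym sepCW) leC tWY z'WY) eqxx.
    by rewrite orbT.
  have := subset_leq_card sZ; have [le _] := leq_card_setU (S :\: Y) [set z; z'].
  by have := cards2 z z'; case: (z != z') => *; card_lia.
have cU := cardsUI (Y :\: W) (Y :\: C); have cSY := cardsID Y S.
by have [_ cYE _] := tY; card_lia.
Qed.

(** The size of [G] forces [~: Y = z |: S] and [#|G| = 2 * k + 3]. Then all neighbors of [z] are in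
    [C], so [#|C| >= k + 1] and only two vertices remain for [W]. *)
Lemma separated_one C W :
  separates C W -> 3 <= #|C| -> 3 <= #|W| -> C :\: Y = set0.
Proof.
move=> sepCW leC leW; apply/eqP; apply: contraT => CY0.
have WY0 := separated_both sepCW leC leW CY0; exfalso.
have /set0Pn[z zCY] := CY0; have [disCW CW nadj] := sepCW.
have /setDP[zC zY] := zCY; have cG := card_tight.
have sZ : ~: Y :\ z \subset S.
  apply/subsetP=> t /setD1P[tz]; rewrite inE => tYn; apply: contraNT tz => tS.
  have : t \in C :|: W by rewrite CW inE.
  case/setUP=> [tC|tW].
    by apply/eqP/(separated_outside sepCW leW) => //; rewrite inE tYn.
  by have : t \in W :\: Y; [rewrite inE tYn | rewrite WY0 inE].
have cZ := cardsD1 z (~: Y); rewrite inE zY in cZ.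
have SE : ~: Y :\ z = S by apply/eqP; rewrite eqEcard sZ /=; card_lia.
have cZk : #|~: Y :\ z| = k by rewrite SE.
have cCW : #|C| + #|W| + k = #|G|.
  rewrite -cS -(cardsC S) addnC -CW; congr (_ + _); apply/esym/eqP.
  by rewrite (leq_card_setU C W).2.
have sN : [set t | adj z t] \subset C :\ z.
  apply/subsetP=> t zt; have tYY := subsetP (neighbors_outside zY) t zt.
  rewrite inE in zt; rewrite !inE; apply/andP; split.
    by apply: contraTneq zt => ->; rewrite adj_irrefl.
  have : t \in C :|: W.
    by rewrite CW -SE !inE tYY andbF.
  by case/setUP=> // tW; have := nadj z t zC tW; rewrite zt.
have := subset_leq_card sN; have := k_connected_degree z.
by have := cardsD1 z C; rewrite zC => *; card_lia.
Qed.

(** Now [~: Y] lies in [S], so [#|G| <= 2 * k + 1]. *)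
Lemma center_separates_false C W :
  separates C W -> 3 <= #|C| -> 3 <= #|W| -> False.
Proof.
move=> sepCW leC leW; have [_ CW _] := sepCW.
have C0 := separated_one sepCW leC leW.
have W0 := separated_one (separates_sym sepCW) leW leC.
have : #|~: Y| <= #|S|.
  apply/subset_leq_card/subsetP=> t tYn; apply: contraT => tS.
  have : t \in (C :|: W) :\: Y by rewrite CW inE inE in tYn *; rewrite tYn inE.
  by rewrite setDUl C0 W0 setU0 inE.
by have := card_tight => *; card_lia.
Qed.

End Separation.

Lemma independence_of_equimatchable S C W :
    #|S| = k -> 2 * k + 3 <= #|G| -> separates S C W -> 3 <= #|C| -> 3 <= #|W| ->
  independence_number G <= 2.
Proof.
move=> cS leG sepCW leC leW; apply/independence_number_leP=> A iA.
rewrite leqNgt; apply/negP=> /exists_subset_card[T sTA cT].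
have [Y [c [tY cY ctr]]] := exists_center (independentS sTA iA) cT.
exact: (center_separates_false tY cY ctr cS leG sepCW leC leW).
Qed.

End TightSets.

(** * Components of [G - S] and the equivalence *)

Section Components.
Variable G : sgraph.
Implicit Types (A C : {set G}).

Lemma linked_equivalence A : {in A & &, equivalence_rel (linked A)}.
Proof.
have symA : connect_sym [rel x y in A | adj x y].
  by apply: sym_connect_sym => x y /=; rewrite adj_sym [(x \in A) && _]andbC.
move=> x y z _ _ _; split; first exact: connect0.
by move=> xy; apply/idP/idP; apply: connect_trans; rewrite // symA.
Qed.

Lemma componentsP A C :
  C \in components A -> exists2 x, x \in A & C = [set y in A | linked A x y].
Proof. by case/imsetP=> x xA ->; exists x. Qed.

Lemma component_isolated A C : C \in components A -> isolated A C.
Proof.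
case/componentsP=> x xA ->; apply/isolatedP; split=> [|y z].
  by apply/subsetP=> y; rewrite inE => /andP[].
rewrite !inE => /andP[yA xy] zA yz; rewrite zA.
by apply: connect_trans xy (connect1 _); rewrite /= yA zA.
Qed.

Lemma components_disjoint A C C' :
    C \in components A -> C' \in components A -> C != C' -> [disjoint C & C'].
Proof.
have /and3P[_ /trivIsetP tC _] := equivalence_partitionP (@linked_equivalence A).
exact: tC.
Qed.

(** One component is set against all the rest of [G - S]; the other component only serves to make
    that rest large. *)
Lemma components_separate S C C' :
    C \in components (~: S) -> C' \in components (~: S) -> C != C' ->
  separates S C (~: S :\: C) /\ C' \subset ~: S :\: C.
Proof.
move=> CS C'S ne; have /isolatedP[sC isoC] := component_isolated CS.
have /isolatedP[sC' _] := component_isolated C'S.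
split; last by rewrite subsetD sC' disjoint_sym (components_disjoint CS).
split.
- by rewrite -setI_eq0 setDE setICA setICr setI0.
- by rewrite -{1}(setIidPr sC) setID.
- move=> x y xC /setDP[yS]; apply: contra; exact: isoC.
Qed.

End Components.

Theorem theorem18 (k : nat) (G : sgraph) (S : {set G})
    (k_ge4 : 4 <= k)
    (G_kconn : k_connected G k)
    (G_odd : odd #|G|)
    (G_large : 2 * k + 3 <= #|G|)
    (S_cut : vertex_cut S)
    (S_card : #|S| = k)
    (S_comps : exists C1 C2 : {set G},
        [/\ C1 \in components (~: S), C2 \in components (~: S), C1 != C2,
            3 <= #|C1| & 3 <= #|C2|]) :
  independence_number G <= 2 <-> equimatchable G /\ factor_critical G.
Proof.
have [C [W [CS WS ne leC leW]]] := S_comps.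
have [sepC sWC] := components_separate CS WS ne.
split=> [alpha|[eqG fcG]].
  split; first exact: equimatchable_of_independence.
  by apply: factor_critical_of_independence G_kconn G_odd alpha; apply: ltn_trans k_ge4.
apply: (independence_of_equimatchable G_odd eqG fcG G_kconn k_ge4 S_card G_large sepC leC).
exact: leq_trans leW (subset_leq_card sWC).
Qed.
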